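(* Let $\Omega\subset\mathbb{R}^N$, $N\ge2$, be a bounded domain with $C^{2,\alpha}$ boundary, let $f$ satisfy the standing assumptions (A) and in addition $f\in C^2((0,+\infty))$, and let $u$ be the minimizer of $J(v)=\int_\Omega[f(|\nabla v|)-v]\,dx$ over $W^{1,\infty}_0(\Omega)$. Assume there exists a sequence $(f_n)$ of convex functions with $f_n(0)=0$, $f_n(s)/s\to\infty$ as $s\to\infty$, satisfying: (i) $f_n\in C^1([0,+\infty))\cap C^3((0,+\infty))$; (ii) $f_n\to f$ uniformly on compact subsets of $[0,+\infty)$; (iii) $f_n'(0)=0$, $f_n'$ decreases in $n$ to $f'$ and $f_n'\to f'$ uniformly on compact subsets of $[0,+\infty)$; (iv) $f_n''>0$ on $(0,+\infty)$; (v) $\lim_{s\to0^+}\frac{sf_n''(s)-f_n'(s)}{s^3}=0$ and $\lim_{s\to0^+}\frac{f_n'(s)}{s}=0$ for each $n$; (vi) $\lim_{n\to\infty}\frac{sf_n''(s)-f_n'(s)}{s^3}=0$ and $\lim_{n\to\infty}\frac{f_n'(s)}{s}=0$ uniformly on compact subsets of $[0,\sigma)$ (the functions being continuously extended by $0$ at $s=0$); (vii) $f_n''\to f''$ uniformly on compact subsets of $(0,+\infty)$. Then $u$ is a viscosity solution in $\Omega$ of $$\min\Big(-\frac{|\nabla u|f''(|\nabla u|)-f'(|\nabla u|)}{|\nabla u|^3}\Delta_\infty u-\frac{f'(|\nabla u|)}{|\nabla u|}\Delta u-1,\ |\nabla u|-\sigma\Big)=0,$$ i.e. of $G(\nabla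 u,D^2u)=0$ with $G(P,X)=\min\big(-\frac{|P|f''(|P|)-f'(|P|)}{|P|^3}P\cdot XP-\frac{f'(|P|)}{|P|}\operatorname{tr}X-1,\ |P|-\sigma\big)$, where the first entry is understood as $-1$ when $P=0$.
   Context: Standing assumptions (A) on $f:[0,+\infty)\to\mathbb{R}$: $f$ convex, nondecreasing, and there is $\sigma>0$ with $f\in C^1([0,+\infty))\cap C^3((\sigma,+\infty))$; $f(0)=0$ and $\lim_{s\to+\infty}f(s)/s=+\infty$; $f'(s)=0$ for $0\le s\le\sigma$; $f''(s)>0$ for $s>\sigma$. $\Delta_\infty u=\sum_{i,j}\partial_{ij}u\,\partial_iu\,\partial_ju$. Viscosity solutions of $G(\nabla v,D^2v)=0$: an u.s.c. $w$ is a subsolution if for every $x_0\in\Omega$ and $\phi\in C^2(\Omega)$ with $w(x_0)=\phi(x_0)$, $w<\phi$ elsewhere, one has $G(\nabla\phi(x_0),D^2\phi(x_0))\le0$; an l.s.c. $w$ is a supersolution if for $\phi$ touching from below strictly ($w(x_0)=\phi(x_0)$, $w>\phi$ elsewhere) one has $G(\nabla\phi(x_0),D^2\phi(x_0))\ge0$; a continuous $w$ is a solution if it is both. *)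

(* Defs.v *)
From HB Require Import structures.
From mathcomp Require Import all_boot all_order all_algebra.
From mathcomp Require Import all_classical all_reals all_analysis.
Set Implicit Arguments. Unset Strict Implicit. Unset Printing Implicit Defensive.
Import Order.TTheory GRing.Theory Num.Theory.
Import numFieldNormedType.Exports.
Local Open Scope classical_set_scope.
Local Open Scope ring_scope.

Section Defs.
Variable R : realType.

Definition enorm (m : nat) (v : 'rV[R]_m) : R := Num.sqrt (\sum_(i < m) v 0 i ^+ 2).

Definition evec (m : nat) (i : 'I_m) : 'rV[R]_m := delta_mx 0 i.

Definition grad (m : nat) (phi : 'rV[R]_m -> R) (x : 'rV[R]_m) : 'rV[R]_m :=
  \row_(i < m) derive phi x (evec i).
Definition hess (m : nat) (phi : 'rV[R]_m -> R) (x : 'rV[R]_m) : 'M[R]_m :=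
  \matrix_(i < m, j < m) derive (fun y => derive phi y (evec j)) x (evec i).

(* phi in C^2(U): all partial derivatives of order <= 2 exist on U and are continuous on U
   (U will always be open) *)
Definition C2_on (m : nat) (U : set 'rV[R]_m) (phi : 'rV[R]_m -> R) : Prop :=
  forall x, U x ->
    {for x, continuous phi} /\
    forall i : 'I_m,
      derivable phi x (evec i) /\
      {for x, continuous (fun y => derive phi y (evec i))} /\
      forall j : 'I_m,
        derivable (fun y => derive phi y (evec j)) x (evec i) /\
        {for x, continuous (fun y => derive (fun z => derive phi z (evec j)) y (evec i))}.

Definition C2alpha_on (alpha : R) (m : nat) (U : set 'rV[R]_m) (g : 'rV[R]_m -> R) : Prop :=
  C2_on U g /\
  forall i j : 'I_m, exists C : R, forall y z, U y -> U z ->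
    `| hess g y i j - hess g z i j | <= C * powR (enorm (y - z)) alpha.

Definition bounded_domain (N : nat) (Om : set 'rV[R]_N) : Prop :=
  Om !=set0 /\ open Om /\ connected Om /\ exists M : R, forall x, Om x -> enorm x <= M.

(* C^{2,alpha} boundary, for Om in R^(n+1): near every boundary point, after a
   rigid change of coordinates centered at x0, Om is the supergraph of a
   C^{2,alpha} function of the first n coordinates. *)
Definition C2alpha_boundary (alpha : R) (n : nat) (Om : set 'rV[R]_n.+1) : Prop :=
  forall x0, closure Om x0 -> ~ Om x0 ->
  exists r : R, 0 < r /\
  exists Q : 'M[R]_n.+1, Q *m Q^T = 1%:M /\
  exists g : 'rV[R]_n -> R,
    C2alpha_on alpha [set y | enorm y < r] g /\
    forall x, enorm (x - x0) < r ->
      (Om x <-> g (\row_(i < n) ((x - x0) *m Q) 0 (widen_ord (leqnSn n) i))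
                  < ((x - x0) *m Q) 0 ord_max).

(* Lebesgue integral over R^m, written as an iterated integral of one-dimensional
   Lebesgue integrals (only applied to bounded measurable integrands with bounded
   support, for which it coincides with the m-dimensional Lebesgue integral). *)
Fixpoint iint (m : nat) : ('rV[R]_m -> R) -> R :=
  match m with
  | 0 => fun g => g 0
  | k.+1 => fun g =>
      Rintegral (@lebesgue_measure R) setT
        (fun t : R => iint (fun y : 'rV[R]_k => g (row_mx (\row_(_ < 1) t) y)))
  end.

(* W^{1,oo}_0(Om): Lipschitz functions vanishing outside Om (extended by 0) *)
Definition W1inf0 (N : nat) (Om : set 'rV[R]_N) (v : 'rV[R]_N -> R) : Prop :=
  (exists L : R, forall x y, `| v x - v y | <= L * enorm (x - y)) /\
  (forall x, ~ Om x -> v x = 0).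

Definition Jfun (N : nat) (f : R -> R) (Om : set 'rV[R]_N) (v : 'rV[R]_N -> R) : R :=
  iint (fun x => if x \in Om then f (enorm (grad v x)) - v x else 0).

Definition is_minimizer (N : nat) (f : R -> R) (Om : set 'rV[R]_N) (u : 'rV[R]_N -> R) : Prop :=
  W1inf0 Om u /\ forall v, W1inf0 Om v -> Jfun f Om u <= Jfun f Om v.

Definition visc_sub (N : nat) (G : 'rV[R]_N -> 'M[R]_N -> R) (Om : set 'rV[R]_N)
  (w : 'rV[R]_N -> R) : Prop :=
  forall x0 phi, Om x0 -> C2_on Om phi -> w x0 = phi x0 ->
    (forall x, Om x -> x != x0 -> w x < phi x) ->
    G (grad phi x0) (hess phi x0) <= 0.
Definition visc_super (N : nat) (G : 'rV[R]_N -> 'M[R]_N -> R) (Om : set 'rV[R]_N)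
  (w : 'rV[R]_N -> R) : Prop :=
  forall x0 phi, Om x0 -> C2_on Om phi -> w x0 = phi x0 ->
    (forall x, Om x -> x != x0 -> w x > phi x) ->
    G (grad phi x0) (hess phi x0) >= 0.
Definition visc_solution (N : nat) (G : 'rV[R]_N -> 'M[R]_N -> R) (Om : set 'rV[R]_N)
  (w : 'rV[R]_N -> R) : Prop :=
  {within Om, continuous w} /\ visc_sub G Om w /\ visc_super G Om w.

Definition Gop (sigma : R) (df d2f : R -> R) (N : nat) (P : 'rV[R]_N) (X : 'M[R]_N) : R :=
  let p := enorm P in
  Num.min
    (if P == 0 then -1
     else - ((p * d2f p - df p) / p ^+ 3) * (P *m X *m P^T) 0 0 - df p / p * \tr X - 1)
    (p - sigma).

Definition convex0 (g : R -> R) : Prop :=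
  forall x y t, 0 <= x -> 0 <= y -> 0 <= t <= 1 ->
    g (t * x + (1 - t) * y) <= t * g x + (1 - t) * g y.
Definition nondecr0 (g : R -> R) : Prop := forall x y, 0 <= x <= y -> g x <= g y.

Definition superlinear (g : R -> R) : Prop := (fun s => g s / s) @ +oo --> +oo.

Definition C1_0 (g dg : R -> R) : Prop :=
  (fun h => (g h - g 0) / h) @ 0^'+ --> dg 0 /\
  (forall s : R, 0 < s -> is_derive s 1 g (dg s)) /\
  {within `[0, +oo[, continuous dg}.

Definition unif_cvg_compact (D : set R) (g : nat -> R -> R) (h : R -> R) : Prop :=
  forall K : set R, compact K -> K `<=` D ->
  forall e : R, 0 < e -> exists N0 : nat, forall m, (N0 <= m)%N ->
    forall s, K s -> `| g m s - h s | < e.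

Definition standingA (sigma : R) (f df d2f : R -> R) : Prop :=
  0 < sigma /\ convex0 f /\ nondecr0 f /\
  C1_0 f df /\
  (forall s : R, sigma < s -> is_derive s 1 df (d2f s) /\ derivable d2f s 1 /\
                          {for s, continuous (derive1 d2f)}) /\
  f 0 = 0 /\ superlinear f /\
  (forall s, 0 <= s <= sigma -> df s = 0) /\
  (forall s, sigma < s -> 0 < d2f s).

Definition C2_pos (df d2f : R -> R) : Prop :=
  forall s : R, 0 < s -> is_derive s 1 df (d2f s) /\ {for s, continuous d2f}.

Definition approx_seq (sigma : R) (f df d2f : R -> R) (fn dfn d2fn : nat -> R -> R) : Prop :=
  (forall n, convex0 (fn n) /\ fn n 0 = 0 /\ superlinear (fn n)) /\
  (forall n, C1_0 (fn n) (dfn n) /\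
     forall s : R, 0 < s -> is_derive s 1 (dfn n) (d2fn n s) /\ derivable (d2fn n) s 1 /\
                        {for s, continuous (derive1 (d2fn n))}) /\
  unif_cvg_compact `[0, +oo[ fn f /\
  (forall n, dfn n 0 = 0) /\
  (forall n s, 0 <= s -> dfn n.+1 s <= dfn n s) /\
  unif_cvg_compact `[0, +oo[ dfn df /\
  (forall n s, 0 < s -> 0 < d2fn n s) /\
  (forall n, (fun s => (s * d2fn n s - dfn n s) / s ^+ 3) @ 0^'+ --> 0 /\
             (fun s => dfn n s / s) @ 0^'+ --> 0) /\
  unif_cvg_compact `[0, sigma[
    (fun n s => if s == 0 then 0 else (s * d2fn n s - dfn n s) / s ^+ 3) (fun _ => 0) /\
  unif_cvg_compact `[0, sigma[
    (fun n s => if s == 0 then 0 else dfn n s / s) (fun _ => 0) /\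
  unif_cvg_compact `]0, +oo[ d2fn d2f.

End Defs.

(* Main.v *)
(* Suppose that [phi] touches [u] strictly at [x0] from above ([s = 1]) or below ([s =
   -1]) and violates the viscosity inequality. With [A = df |grad phi| / |grad phi|
   grad phi], the first entry of [Gop] along [phi] is [- div A - 1], or [-1] where the
   flux [A] vanishes; hence [- s (div A + 1) > 0] on a box around [x0]. Put [w = (s (u
   - phi) + del)^+] there and compare [u] with [v = u - s w]. Convexity of [f] gives,
   almost everywhere, [f |grad u| - u - (f |grad v| - v) >= s (div (A w) - (div A + 1)
   w)], and the integral of [div (A w)] is zero, so that [J u > J v], against
   minimality. The almost everywhere statements rest on the differentiability of
   Lipschitz functions along lines, obtained from the Radon-Nikodym theorem. *)
Require Import Defs.
From HB Require Import structures.
From mathcomp Require Import all_boot all_order all_algebra.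
From mathcomp Require Import all_classical all_reals all_analysis.
From mathcomp Require Import measurable_realfun ring lra.
Set Implicit Arguments. Unset Strict Implicit. Unset Printing Implicit Defensive.
Import Order.TTheory GRing.Theory Num.Theory.
Import numFieldNormedType.Exports.
Local Open Scope classical_set_scope.
Local Open Scope ring_scope.

(** Where [w > 0] the competitor is [phi] up to a constant, so convexity is applied at [grad phi]:
    only the flux of [phi] is ever differentiated, and [u] enters through its first partial
    derivatives alone. Since [grad] is made of partial derivatives, differentiability along the
    coordinate axes takes the place of total differentiability. The flux could be singular where
    [grad phi] vanishes; as [sigma > 0], either [grad phi x0] is shorter than [sigma] and the flux
    is zero near [x0], or [grad phi] is nonzero near [x0] and the flux is regular there. The
    integral of [div (A w)] is computed from difference quotients: translation invariance makes
    their integrals zero, and dominated convergence passes this to the derivatives. These tools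
    require a measure, whereas [J] is an iterated integral; so Lebesgue measure on row vectors is
    built one coordinate at a time, and Fubini identifies the two integrals for bounded measurable
    functions with bounded support. *)

(** * Almost everywhere derivability of Lipschitz functions of one variable *)

Section lipschitz1.
Variable R : realType.
Implicit Types (g : R -> R) (L : R).
Local Notation leb := (@lebesgue_measure R).

Section tilt.
Variables (g : R -> R) (L : R) (Lg : forall x y, `|g x - g y| <= L * `|x - y|).

(* Adding a multiple of the identity makes [g] nondecreasing, so that it has a
   Stieltjes measure, which is absolutely continuous. *)
Definition tilt (x : R) : R := g x + L * x.

Let tilt_nd : {homo tilt : x y / x <= y}.
Proof.
move=> x y xy; rewrite /tilt.
have := Lg x y; rewrite (distrC x) (ger0_norm (_ : 0 <= y - x)) ?subr_ge0// ler_norml.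
by move=> /andP[h1 h2]; lra.
Qed.

Let L_ge0 : 0 <= L.
Proof. by have := Lg 1 0; rewrite subr0 normr1 mulr1; apply: le_trans. Qed.

Lemma tilt_le x y : x <= y -> tilt y - tilt x <= (2 * L) * (y - x).
Proof.
move=> xy; rewrite /tilt.
have := Lg x y; rewrite (distrC x) (ger0_norm (_ : 0 <= y - x)) ?subr_ge0// ler_norml.
by move=> /andP[h1 h2]; lra.
Qed.

Let tilt_rc : right_continuous tilt.
Proof.
apply: right_continuousW => x; apply/(@cvgrPdist_le _ R^o) => e e0.
near=> y.
have h : `|tilt x - tilt y| <= 2 * L * `|x - y|.
  have [xy|/ltW yx] := leP x y.
    rewrite distrC (distrC x) !ger0_norm ?subr_ge0 ?tilt_nd//; exact: tilt_le.
  rewrite !ger0_norm ?subr_ge0 ?tilt_nd//; exact: tilt_le.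
apply: (le_trans h).
have L1 : 0 < 2 * L + 1 by have := L_ge0; lra.
apply: (@le_trans _ _ ((2 * L + 1) * `|x - y|)).
  by apply: ler_wpM2r => //; lra.
rewrite -ler_pdivlMl//.
near: y; apply: cvgr_dist_le; [exact: cvg_id|].
by rewrite mulr_gt0 ?invr_gt0//; have := L_ge0; lra.
Unshelve. all: by end_near. Qed.

HB.instance Definition _ := isCumulative.Build R _ R tilt tilt_nd tilt_rc.

Let nu := lebesgue_stieltjes_measure tilt.

(** The summand [1] keeps [c] invertible when [L = 0]. *)
Let c := 2 * L + 1.
Let c_gt0 : 0 < c. Proof. by rewrite /c; have := L_ge0; lra. Qed.

Let wlength_tilt X : ocitv X -> (wlength tilt X <= c%:E * wlength idfun X)%E.
Proof.
move=> /ocitvP[->|[x x12 ->]]; first by rewrite !wlength0 mule0.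
rewrite !(wlength_itv_bnd _ _ _ (ltW x12)) /= -EFinM lee_fin.
apply: (le_trans (tilt_le (ltW x12))); apply: ler_wpM2r; rewrite /c ?subr_ge0; [exact: ltW|lra].
Qed.

(** Both measures are infima over covers by half-open intervals, so the comparison of lengths
    extends to every set; Lebesgue null sets are therefore null for [nu]. *)
Let nu_le A : ((c^-1)%:E * nu A <= leb A)%E.
Proof.
rewrite /lebesgue_measure /lebesgue_stieltjes_measure /measure_extension.
apply: le_ereal_inf_tmp => _ [F [mF AF] <-].
rewrite lee_pdivrMl//.
rewrite -nneseriesZl//.
apply: (@le_trans _ _ (\sum_(0 <= k <oo) wlength tilt (F k))%E).
  by apply: ereal_inf_lbound; exists F => //; split.
apply: lee_nneseries => // i _.
apply: wlength_tilt; exact: mF.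
Qed.

Let nuD (a b : R) : @measurable _ (measurableTypeR R) (`]a, b]%classic : set R). Proof. exact: measurable_itv. Qed.

Let nu_itv (a b : R) : a <= b -> nu `]a, b]%classic = (tilt b - tilt a)%:E.
Proof.
move=> ab; rewrite /nu /lebesgue_stieltjes_measure /measure_extension.
by rewrite measurable_mu_extE/= ?wlength_itv_bnd//; exact: is_ocitv.
Qed.

Let nu_itv_fin (a b : R) : (nu `]a, b]%classic < +oo)%E.
Proof.
have [ab|ba] := leP a b; first by rewrite nu_itv// ltry.
by rewrite /nu set_itv_ge ?bnd_simp -?leNgt ?ltW// measure0.
Qed.

(** Restricted to []a, b]] the measure [nu] is finite, so its density is integrable. The increment
    [tilt y - tilt a] is the integral of that density, which the fundamental theorem of calculus
    differentiates almost everywhere, and [g] differs from [tilt] by a linear term. *)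
Lemma lipschitz_ae_derivable_itv (a b : R) : {ae leb, forall x, a < x < b -> derivable g x 1}.
Proof.
pose m : {finite_measure set (measurableTypeR R) -> \bar R} := mfrestr (nuD a b) (nu_itv_fin a b).
have mleb : m `<< leb.
  apply/null_content_dominatesP => A mA A0.
  rewrite /m /mfrestr /mrestr.
  have h : (nu A <= 0)%E.
    by have := nu_le A; rewrite A0 lee_pdivrMl// mule0.
  apply/eqP; rewrite eq_le measure_ge0 andbT; apply: le_trans h.
  by apply: le_measure; rewrite ?inE//; exact: measurableI.
have [rho [rho0 rhofin rhoint rhoE]] := radon_nikodym_sigma_finite mleb.
pose r := fine \o rho.
have rE : EFin \o r = rho by apply/funext => x; rewrite /= fineK.
have := @FTC1 R r (BRight a); rewrite rE.
move=> /(_ (fun y => integrableS measurableT (nuD a y) (@subsetT _ _) rhoint)).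
have loc : locally_integrable [set: R] r.
  by apply: (@open_integrable_locally _ [set: R] r); [exact: openT|rewrite rE].
move=> /(_ loc); apply: filterS; first exact: (ae_filter_ringOfSetsType leb).
move=> x H /andP[ax xb].
have {}H := (H ax).1.
set F := (fun _ => _) in H.
have gE : {near x, g =1 (fun y => F y + (tilt a - L * y))}.
  near=> y.
  have ay : a < y by near: y; apply: lt_nbhsr.
  have yb : y < b by near: y; apply: lt_nbhsl.
  have : m `]a, y]%classic = (tilt y - tilt a)%:E.
    rewrite (_ : m _ = nu (`]a, y] `&` `]a, b]))// setIidl ?nu_itv ?ltW//.
    by apply: subset_itvl; rewrite bnd_simp ltW.
  rewrite rhoE; last exact: measurable_itv.
  move=> E; rewrite /F /Rintegral (_ : (fun x => (r x)%:E) = rho); last first.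
    by apply/funext => z; rewrite -rE.
  by rewrite E/= /tilt; lra.
apply: (near_eq_derivable (f := fun y => F y + (tilt a - L * y))) => //.
  by near=> y; apply/esym; near: y.
apply: derivableD => //; apply: derivableB => //.
Unshelve. all: by end_near. Qed.

Lemma lipschitz_ae_derivable : {ae leb, forall x, derivable g x 1}.
Proof.
have H : {ae leb, forall x, forall n : nat, - n%:R < x < n%:R -> derivable g x 1}.
  apply: ae_foralln => n; exact: lipschitz_ae_derivable_itv.
move: H; apply: filterS; first exact: (ae_filter_ringOfSetsType leb).
move=> x H.
apply: (H (Num.bound `|x|)).
by rewrite -ltr_norml archi_boundP.
Qed.
End tilt.
End lipschitz1.

(** * Lebesgue measure on row vectors *)

(** An identity sealed by [Qed], which keeps the display of row vectors distinct from that of the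
    scalars. *)
Definition rV_display : measure_display -> measure_display. Proof. exact. Qed.

Section measurable_rV.
Variables (R : realType) (k : nat).

Let coord (i : 'I_k) (v : 'rV[R]_k) : R := v 0 i.

Let rV_set0 : g_sigma_preimage coord set0.
Proof. exact: sigma_algebra0. Qed.

Let rV_setC A : g_sigma_preimage coord A -> g_sigma_preimage coord (~` A).
Proof. exact: sigma_algebraC. Qed.

Let rV_bigcup (F : _^nat) : (forall i, g_sigma_preimage coord (F i)) ->
  g_sigma_preimage coord (\bigcup_i (F i)).
Proof. exact: sigma_algebra_bigcup. Qed.

(** The sigma-algebra is generated by the coordinates, so that maps into row vectors are tested one
    coordinate at a time; that it contains the open sets is a separate fact,
    [open_measurable_rV]. *)
HB.instance Definition _ := @isMeasurable.Build (rV_display default_measure_display)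
  'rV[R]_k (g_sigma_preimage coord) rV_set0 rV_setC rV_bigcup.

Lemma measurable_coord (i : 'I_k) : measurable_fun setT (fun v : 'rV[R]_k => v 0 i).
Proof.
move=> _ Y mY; rewrite setTI; apply: sub_sigma_algebra => /=.
rewrite -bigcup_seq/=; exists i => //=; first by rewrite mem_index_enum.
by exists Y => //; rewrite setTI.
Qed.

Lemma measurable_fun_rVP d (T : measurableType d) (f : T -> 'rV[R]_k) :
  measurable_fun setT f <-> forall i, measurable_fun setT (fun x => f x 0 i).
Proof.
split=> [mf i|mf].
  exact: (measurableT_comp (measurable_coord i) mf).
apply: (measurability (\big[setU/set0]_(i < k) preimage_set_system setT (coord i) measurable)) => //.
move=> _ [B + <-]; rewrite -bigcup_seq/= => -[i _] [Y mY <-].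
by rewrite setTI; exact: mf.
Qed.

End measurable_rV.

Lemma coord_le_norm (R : realType) k (v : 'rV[R]_k) i : `|v 0 i| <= `|v|.
Proof.
rewrite [leRHS]/Num.norm /= mx_normrE.
exact: (@le_bigmax _ _ _ 0 (fun ij : 'I_1 * 'I_k => `|v ij.1 ij.2|) (0, i)).
Qed.

Lemma rV_norm_le (R : realType) k (v : 'rV[R]_k) (M : R) :
  0 <= M -> (forall i, `|v 0 i| <= M) -> `|v| <= M.
Proof.
move=> M0 vM; rewrite [leLHS]/Num.norm /= mx_normrE.
by apply/bigmax_leP; split=> // -[i j] _ /=; rewrite ord1.
Qed.

Section open_rV.
Variables (R : realType) (k : nat).

Lemma ball_rVE (x : 'rV[R]_k) (e : R) : 0 < e ->
  ball x e = \bigcap_(i in [set: 'I_k]) [set y : 'rV[R]_k | ball (x 0 i) e (y 0 i)].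
Proof.
move=> e0; apply/seteqP; split=> y /=.
  by move=> [_ h] i _ /=; exact: h.
by move=> h; split=> // i j; rewrite ord1; exact: (h j I).
Qed.

Lemma measurable_ball_rV (x : 'rV[R]_k) (e : R) : measurable (ball x e).
Proof.
have [e0|e0] := ltP 0 e; last first.
  rewrite (_ : ball x e = set0)// -subset0 => y [] + _; by rewrite ltNge e0.
rewrite ball_rVE//; apply: fin_bigcap_measurable => // i _.
have := @measurable_coord R k i measurableT _ (measurable_ball (x 0 i) e).
by rewrite setTI.
Qed.

(** A ball of the sup norm is a finite intersection of coordinate preimages, and an open set is the
    union of the countably many balls with rational center and radius that it contains. *)
Lemma open_measurable_rV (U : set 'rV[R]_k) : open U -> measurable U.
Proof.
move=> oU.
pose B (p : 'rV[rat]_k * rat) : set 'rV[R]_k :=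
  [set y | ball (map_mx ratr p.1 : 'rV[R]_k) (ratr p.2) y /\
           ball (map_mx ratr p.1 : 'rV[R]_k) (ratr p.2 : R) `<=` U].
have -> : U = \bigcup_(p in [set: 'rV[rat]_k * rat]) B p.
  apply/seteqP; split=> [x Ux|x [p _ []]]; last by move=> Bx; exact.
  have /nbhs_ballP[e /= e0 eU] : nbhs x U by exact: open_nbhs_nbhs.
  have e40 : 0 < e / 4 by rewrite divr_gt0.
  (* With a center at distance less than [e / 4] from [x], a radius above [e / 4] catches [x], and a
     radius below [e / 2] keeps the ball inside [ball x e]. *)
  have [q /andP[q1 q2]] : exists q : rat, (e / 4 < ratr q) && (ratr q < e / 2).
    have [|q] := @rat_in_itvoo R (e / 4) (e / 2); first by lra.
    by rewrite in_itv/= => h; exists q.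
  have /choice[p hp] : forall i : 'I_k, exists r : rat, `|x 0 i - ratr r| < e / 4.
    move=> i; have [|r] := @rat_in_itvoo R (x 0 i - e / 4) (x 0 i + e / 4); first by lra.
    rewrite in_itv/= => h; exists r; rewrite ltr_norml; lra.
  have q0 : 0 < (ratr q : R) by lra.
  exists (\row_i p i, q) => //=.
  have xB : ball (map_mx ratr (\row_i p i) : 'rV[R]_k) (ratr q) x.
    split=> // i j; rewrite ord1 !mxE; rewrite /ball/= distrC.
    exact: lt_trans (hp j) q1.
  split=> // y By; apply: eU.
  have -> : e = e / 2 + e / 2 by lra.
  apply: (@ball_triangle _ _ (map_mx ratr (\row_i p i) : 'rV[R]_k)).
    apply/ball_sym; apply: le_ball xB; exact: ltW.
  apply: le_ball By; exact: ltW.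
apply: countable_bigcupT_measurable; first exact: countableP.
move=> p; have [h|h] := pselect (ball (map_mx ratr p.1 : 'rV[R]_k) (ratr p.2 : R) `<=` U).
  rewrite (_ : B p = ball (map_mx ratr p.1 : 'rV[R]_k) (ratr p.2)); first exact: measurable_ball_rV.
  by apply/seteqP; split=> [y []|y].
rewrite (_ : B p = set0)// -subset0 => y [] _; exact: h.
Qed.

Lemma closed_measurable_rV (U : set 'rV[R]_k) : closed U -> measurable U.
Proof.
move=> cU; rewrite -(setCK U); apply: measurableC; apply: open_measurable_rV.
exact: closed_openC.
Qed.

Lemma continuous_measurable_rV (f : 'rV[R]_k -> R) : continuous f -> measurable_fun setT f.
Proof.
move=> cf; apply: (measurability (@RGenOpens.G R)); first exact: RGenOpens.measurableE.
move=> _ [_ [a [b ->]] <-]; rewrite setTI; apply: open_measurable_rV.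
by apply: open_comp => [x _|]; [exact: cf|exact: itv_open].
Qed.

End open_rV.

Section cons_measure.
Variables (R : realType) (k : nat).
Local Notation leb := (@lebesgue_measure R).
Local Notation mR := (measurableTypeR R).

Definition rV_cons (p : mR * 'rV[R]_k) : 'rV[R]_k.+1 :=
  row_mx (\row_(_ < 1) (p.1 : R)) p.2.
Definition rV_uncons (v : 'rV[R]_k.+1) : mR * 'rV[R]_k :=
  (v 0 0, \row_i v 0 (lift 0 i)).

Lemma rV_cons0 p : rV_cons p 0 0 = p.1.
Proof.
have -> : (0 : 'I_k.+1) = lshift k (0 : 'I_1) by apply: val_inj.
by have := row_mxEl (\row_(_ < 1) (p.1 : R)) p.2 0 0; rewrite mxE.
Qed.

Lemma rV_consS p i : rV_cons p 0 (lift 0 i) = p.2 0 i.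
Proof.
have -> : lift (0 : 'I_k.+1) i = rshift 1 (i : 'I_k) by apply: val_inj.
exact: (row_mxEr (\row_(_ < 1) (p.1 : R)) p.2 0).
Qed.

Lemma rV_consK : cancel rV_cons rV_uncons.
Proof.
move=> p; rewrite /rV_uncons rV_cons0 [RHS]surjective_pairing; congr pair.
by apply/rowP => i; rewrite mxE rV_consS.
Qed.

Lemma measurable_rV_cons : measurable_fun setT rV_cons.
Proof.
apply/measurable_fun_rVP => i; have [j ->|->] := unliftP 0 i.
  under eq_fun do rewrite rV_consS.
  exact: (measurableT_comp (measurable_coord j) measurable_snd).
under eq_fun do rewrite rV_cons0.
exact: measurable_fst.
Qed.

Lemma measurable_rV_uncons : measurable_fun setT rV_uncons.
Proof.
apply: measurable_fun_pair; first exact: measurable_coord.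
apply/measurable_fun_rVP => i; under eq_fun do rewrite mxE.
exact: measurable_coord.
Qed.

Variable m : {sigma_finite_measure set 'rV[R]_k -> \bar R}.

(** The first coordinate is split off as in [iint], so that Fubini yields exactly the iterated
    integral of the functional. *)
Definition cons_measure : set 'rV[R]_k.+1 -> \bar R :=
  pushforward (leb \x m)%E rV_cons.

Let cons0 : cons_measure set0 = 0%E.
Proof. by rewrite /cons_measure /pushforward preimage_set0 measure0. Qed.

Let cons_ge0 A : (0 <= cons_measure A)%E.
Proof. by rewrite /cons_measure /pushforward measure_ge0. Qed.

Let cons_additive : semi_sigma_additive cons_measure.
Proof.
exact: (@measure_semi_sigma_additive _ _ _
  (measure_function_pushforward__canonical__measure_function_Measure
     (leb \x m)%E measurable_rV_cons)).
Qed.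

HB.instance Definition _ := isMeasure.Build _ _ _ cons_measure cons0 cons_ge0 cons_additive.

Let cons_sigma_finite : sigma_finite setT cons_measure.
Proof.
have /sigma_finiteP[F [FT ndF Ffin]] := sigma_finiteT leb.
have /sigma_finiteP[G [GT ndG Gfin]] := sigma_finiteT m.
exists (fun n => rV_uncons @^-1` (F n `*` G n)).
  apply/esym; rewrite -subTset => v _.
  have [n _ Fn] : (\bigcup_n F n) (rV_uncons v).1 by rewrite -FT.
  have [l _ Gl] : (\bigcup_n G n) (rV_uncons v).2 by rewrite -GT.
  exists (maxn n l) => //; split.
    by move: Fn; apply/subsetPset; exact/ndF/leq_maxl.
  by move: Gl; apply/subsetPset; exact/ndG/leq_maxr.
move=> n; have [mF Fy] := Ffin n; have [mG Gy] := Gfin n; split.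
  rewrite -[X in measurable X]setTI; apply: measurable_rV_uncons => //.
  exact: measurableX.
rewrite /cons_measure /pushforward (_ : _ @^-1` _ = F n `*` G n).
  by rewrite product_measure1E// lte_mul_pinfty// ge0_fin_numE.
rewrite -comp_preimage (_ : rV_uncons \o rV_cons = id) ?preimage_id//.
by apply/funext => p; exact: rV_consK.
Qed.

HB.instance Definition _ :=
  @Measure_isSigmaFinite.Build _ _ _ cons_measure cons_sigma_finite.

Lemma ge0_integral_cons (f : 'rV[R]_k.+1 -> \bar R) :
  measurable_fun setT f -> (forall x, 0 <= f x)%E ->
  (\int[cons_measure]_x f x = \int[leb]_t \int[m]_y f (rV_cons (t, y)))%E.
Proof.
move=> mf f0; rewrite /cons_measure ge0_integral_pushforward//; last exact: measurable_rV_cons.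
rewrite preimage_setT fubini_tonelli1//; first exact: measurableT_comp mf measurable_rV_cons.
by move=> x; exact: f0.
Qed.

Lemma integral_cons (f : 'rV[R]_k.+1 -> \bar R) :
  cons_measure.-integrable setT f ->
  (\int[cons_measure]_x f x = \int[leb]_t \int[m]_y f (rV_cons (t, y)))%E.
Proof.
move=> /integrableP[mf fi].
have fi' : ((leb \x m)%E).-integrable setT (f \o rV_cons).
  apply/integrableP; split.
    exact: measurableT_comp mf measurable_rV_cons.
  move: fi; rewrite /cons_measure ge0_integral_pushforward ?preimage_setT//.
    exact: measurable_rV_cons.
  exact: measurableT_comp.
rewrite /cons_measure integral_pushforward//; last exact: measurable_rV_cons.
by rewrite preimage_setT -integral12_prod_meas1.
Qed.

End cons_measure.

Fixpoint lebesgue_rV (R : realType) (k : nat) : {sigma_finite_measure set 'rV[R]_k -> \bar R} :=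
  match k with
  | 0 => dirac (0 : 'rV[R]_0)
  | k'.+1 => cons_measure (lebesgue_rV R k')
  end.

(** * Translation invariance, measure of balls, agreement with [iint] *)

Section lebesgue_rV_theory.
Variable R : realType.
Local Notation leb := (@lebesgue_measure R).
Local Notation mR := (measurableTypeR R).
Local Notation mu k := (lebesgue_rV R k).

Let measurable_translate1 (a : R) : @measurable_fun _ _ mR mR setT (fun x : mR => (x : R) + a).
Proof.
suff : @measurable_fun _ _ mR R setT (fun x : mR => (x : R) + a) by [].
apply: (@measurable_funD _ mR R setT (fun x : mR => x : R) (cst a)) => //.
Qed.

(** Lebesgue measure is determined by its values on half-open intervals, and translation preserves
    their length. *)
Lemma lebesgue_measure_translate (a : R) (A : set mR) : measurable A ->
  leb [set x : mR | A ((x : R) + a)] = leb A.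
Proof.
have mt : measurable_fun (setT : set mR) (fun x : mR => (x : R) + a : mR).
  exact: measurable_translate1.
move=> mA; apply/esym.
apply: (@lebesgue_measure_unique R
  (measure_function_pushforward__canonical__measure_function_Measure leb mt)) mA => /=.
move=> X /ocitvP[->|[x x12 ->]]; first by rewrite /pushforward preimage_set0 !measure0.
rewrite /pushforward (_ : _ @^-1` _ = `](x.1 - a), (x.2 - a)]%classic); last first.
  by apply/seteqP; split=> y /=; rewrite !in_itv/= ltrBlDr lerBrDr.
rewrite !lebesgue_measure_itv/= !lte_fin ltrD2r x12 -!EFinB; congr EFin; ring.
Qed.

Lemma ge0_integral_translate1 (a : R) (f : mR -> \bar R) :
  measurable_fun setT f -> (forall x, 0 <= f x)%E ->
  (\int[leb]_x f ((x : R) + a)%R = \int[leb]_x f x)%E.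
Proof.
have mt : measurable_fun (setT : set mR) (fun x : mR => (x : R) + a : mR).
  exact: measurable_translate1.
move=> mf f0.
transitivity (\int[pushforward leb (fun x : mR => ((x : R) + a)%R : mR)]_y f y)%E.
  by rewrite ge0_integral_pushforward.
apply: eq_measure_integral => A mA _; exact: lebesgue_measure_translate.
Qed.

Lemma measurable_translate k (a : 'rV[R]_k) : measurable_fun setT (fun x : 'rV[R]_k => x + a).
Proof.
apply/measurable_fun_rVP => i; under eq_fun do rewrite mxE.
by apply: measurable_funD => //; exact: measurable_coord.
Qed.

Lemma ge0_integral_translate k (a : 'rV[R]_k) (f : 'rV[R]_k -> \bar R) :
  measurable_fun setT f -> (forall x, 0 <= f x)%E ->
  (\int[mu k]_x f (x + a)%R = \int[mu k]_x f x)%E.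
Proof.
elim: k a f => [|k IH] a f mf f0.
  by rewrite (_ : a = 0) ?thinmx0//; apply: eq_integral => x _; rewrite addr0.
rewrite /= !ge0_integral_cons//; last first.
  exact: measurableT_comp mf (measurable_translate a).
pose b : 'rV[R]_k := \row_i a 0 (lift 0 i).
have E t y : rV_cons (t, y) + a = rV_cons (((t : R) + a 0 0 : mR), y + b).
  apply/rowP => i; rewrite mxE; have [j ->|->] := unliftP 0 i.
    by rewrite !rV_consS/= !mxE.
  by rewrite !rV_cons0.
under eq_integral => t _ do under eq_integral => y _ do rewrite E.
have mft t : measurable_fun setT (fun y => f (rV_cons (t, y))).
  apply: measurableT_comp mf _; apply: measurableT_comp (@measurable_rV_cons R k) _.
  exact: measurable_pair1.
under eq_integral => t _.
  rewrite (IH b (fun y => f (rV_cons (((t : R) + a 0 0)%R, y))))//; over.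
rewrite (ge0_integral_translate1 (a 0 0) (f := fun t => (\int[mu k]_y f (rV_cons (t, y)))%E))//.
  apply: (measurable_fun_fubini_tonelli_F (fun p => f (rV_cons p))) => //.
  exact: measurableT_comp mf (@measurable_rV_cons R k).
by move=> t; apply: integral_ge0.
Qed.

(** A ball of the sup norm is a product of intervals. Finiteness gives integrability of bounded
    functions with bounded support; positivity makes the gain of the competitor strict. *)
Lemma lebesgue_rV_ball k (x : 'rV[R]_k) (e : R) : 0 < e -> (0 < mu k (ball x e) < +oo)%E.
Proof.
move=> e0; elim: k x => [|k IH] x.
  rewrite /= diracE mem_set ?lte_fin ?ltr01 ?ltry//.
  by split=> // i [].
rewrite /= /cons_measure /pushforward.
rewrite (_ : _ @^-1` _ = (ball (x 0 0) e : set mR) `*` ball (\row_i x 0 (lift 0 i)) e); last first.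
  apply/seteqP; split=> [[t y] /= [_ h]|[t y] /= [h1 [_ h2]]].
    split; first by have := h 0 0; rewrite rV_cons0.
    split=> // i j; rewrite ord1 mxE; have := h 0 (lift 0 j).
    by rewrite rV_consS.
  split=> // i j; rewrite ord1; have [l ->|->] := unliftP 0 j.
    by rewrite rV_consS; have := h2 0 l; rewrite mxE.
  by rewrite rV_cons0.
rewrite product_measure1E; last 2 first.
  - exact: measurable_ball.
  - exact: measurable_ball_rV.
rewrite [X in (X * _)%E](_ : _ = (e *+ 2)%:E); last exact: lebesgue_measure_ball (ltW e0).
have /andP[h1 h2] := IH (\row_i x 0 (lift 0 i)).
apply/andP; split; first by rewrite mule_gt0// lte_fin mulrn_wgt0.
by rewrite lte_mul_pinfty// lee_fin mulrn_wge0// ltW.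
Qed.

(** Bounded, measurable, of bounded support: the class in which every integrand of the proof lies,
    stable under slicing and translation. *)
Definition bms k (g : 'rV[R]_k -> R) : Prop :=
  [/\ measurable_fun setT g, exists M : R, forall x, `|g x| <= M &
      exists r : R, forall x : 'rV[R]_k, r <= `|x| -> g x = 0].

Lemma bms_integrable k (g : 'rV[R]_k -> R) : bms g -> (mu k).-integrable setT (EFin \o g).
Proof.
move=> [mg [M gM] [r gr]].
pose B : set 'rV[R]_k := ball 0 (`|r| + 1).
have B_fin : (mu k B < +oo)%E.
  by have /andP[] := @lebesgue_rV_ball k 0 (`|r| + 1) (ltr_wpDl (normr_ge0 _) ltr01).
have mB : measurable B by exact: measurable_ball_rV.
have gE : EFin \o g = (EFin \o g) \_ B.
  apply/funext => x; rewrite patchE; case: ifPn => //; rewrite notin_setE => Bx /=.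
  rewrite gr//; rewrite leNgt; apply/negP => xr; apply: Bx.
  rewrite /B mx_norm_ball /ball_/= sub0r normrN (lt_le_trans xr)//.
  by rewrite (le_trans (ler_norm r))// lerDl.
rewrite gE; apply: (proj1 (integrable_mkcond (EFin \o g) mB)).
apply: measurable_bounded_integrable => //; first exact: measurable_funTS.
exists M; split; first exact: num_real.
by move=> y My x _ /=; rewrite (le_trans (gM x))// ltW.
Qed.

Lemma bms_cons k (g : 'rV[R]_k.+1 -> R) (t : R) : bms g -> bms (fun y => g (rV_cons (t : mR, y))).
Proof.
move=> [mg [M gM] [r gr]]; split.
- apply: measurableT_comp mg _; apply: measurableT_comp (@measurable_rV_cons R k) _.
  exact: measurable_pair1.
- by exists M => y.
- exists r => y ry; apply: gr; apply: (le_trans ry).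
  apply: rV_norm_le => // i; rewrite -(rV_consS (t : mR, y) i); exact: coord_le_norm.
Qed.

Lemma bms_iint k (g : 'rV[R]_k -> R) : bms g -> iint g = Rintegral (mu k) setT g.
Proof.
elim: k g => [|k IH] g bg.
  rewrite /= /Rintegral integral_dirac//=; last by case: bg => mg _ _; exact/measurable_EFinP.
  by rewrite indicE in_setT mul1r.
rewrite /= /Rintegral (integral_cons (bms_integrable bg)); congr fine.
apply: eq_integral => t _.
rewrite (_ : (fun y => _) = (fun y => g (rV_cons (t, y))))//.
rewrite (IH _ (bms_cons _ bg)) /Rintegral fineK//.
apply: integrable_fin_num => //; exact: (bms_integrable (bms_cons _ bg)).
Qed.

End lebesgue_rV_theory.

(** * Continuity of real functions at a point *)

Section continuity.
Variables (R : realType) (T : topologicalType).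
Implicit Types (f g : T -> R) (x : T).

Lemma cont_cst (c : R) x : {for x, continuous (fun _ : T => c)}.
Proof. exact: cvg_cst. Qed.

Lemma contD f g x : {for x, continuous f} -> {for x, continuous g} ->
  {for x, continuous (fun y => f y + g y)}.
Proof. exact: continuousD. Qed.

Lemma contB f g x : {for x, continuous f} -> {for x, continuous g} ->
  {for x, continuous (fun y => f y - g y)}.
Proof. exact: continuousB. Qed.

Lemma contM f g x : {for x, continuous f} -> {for x, continuous g} ->
  {for x, continuous (fun y => f y * g y)}.
Proof. exact: continuousM. Qed.

Lemma cont_norm f x : {for x, continuous f} -> {for x, continuous (fun y => `|f y|)}.
Proof. by move=> cf; exact: (continuous_comp cf (@norm_continuous R R^o (f x))). Qed.

Lemma cont_sum m (F : 'I_m -> T -> R) x : (forall i, {for x, continuous (F i)}) ->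
  {for x, continuous (fun y => \sum_i F i y)}.
Proof.
move=> cF.
suff : forall l : seq 'I_m, {for x, continuous (fun y => \sum_(i <- l) F i y)} by exact.
elim=> [|i l IH].
  rewrite (_ : (fun y => _) = (fun=> 0)); first exact: cont_cst.
  by apply/funext => y; rewrite big_nil.
rewrite (_ : (fun y => _) = (fun y => F i y + \sum_(i <- l) F i y)).
  by apply: contD => //; exact: cF.
by apply/funext => y; rewrite big_cons.
Qed.

Lemma compact_fun_bounded (K : set T) f : compact K ->
  (forall x, K x -> {for x, continuous f}) -> exists M, forall x, K x -> `|f x| <= M.
Proof.
move=> cK cf.
have cc : compact (f @` K).
  apply: continuous_compact => //.
  by apply: continuous_in_subspaceT => x /set_mem; exact: cf.
have [M [_ hM]] := compact_bounded cc.
by exists (M + 1) => x bx; apply: (hM (M + 1)); [rewrite ltrDl|exists x].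
Qed.

End continuity.

Lemma cont_shift (R : realType) (V : normedModType R) (a x : V) :
  {for x, continuous (fun y => a + y)}.
Proof. by apply: cvgD; [exact: cvg_cst|exact: cvg_id]. Qed.

(** * Directional derivatives of functions that are Lipschitz along a direction *)

Section difference_quotient.
Variables (R : realType) (k : nat).
Implicit Types (g : 'rV[R]_k -> R) (v x : 'rV[R]_k).

(** The order of the terms in [h *: v + x] makes [derivable] and [derive] limits of [dquot] by
    conversion. *)
Definition dquot g v x (h : R) : R := h^-1 * (g (h *: v + x) - g x).

Lemma derivable_dquot g v x : derivable g x v = cvg (dquot g v x h @[h --> 0^']).
Proof. by []. Qed.

Lemma derive_dquot g v x : derive g x v = lim (dquot g v x h @[h --> 0^']).
Proof. by []. Qed.

Lemma cvg_dnbhs0P (q : R -> R) (l : R) : q h @[h --> 0^'] --> l <->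
  forall e, 0 < e -> exists2 d, 0 < d & forall h, h != 0 -> `|h| < d -> `|l - q h| <= e.
Proof.
split=> [/cvgrPdist_le H e e0|H].
  have [d /= d0 hd] := H e e0; exists d => // h h0 hd'.
  by apply: hd => //=; rewrite sub0r normrN.
apply/cvgrPdist_le => e e0; have [d d0 hd] := H e e0.
by exists d => // h /= hd' h0; apply: hd => //; rewrite -normrN -sub0r.
Qed.

Lemma is_derive_dquotP g v x (l : R) : is_derive x v g l <->
  forall e, 0 < e -> exists2 d, 0 < d & forall h, h != 0 -> `|h| < d -> `|l - dquot g v x h| <= e.
Proof.
rewrite -cvg_dnbhs0P; split=> [[dg <-]|H].
  exact: dg.
split; first by apply/cvg_ex; exists l.
by rewrite derive_dquot; apply/cvg_lim.
Qed.

Lemma dquot_line g v x (s : R) : dquot g v (s *: v + x) =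
  (fun h : R => h^-1 *: (((fun t : R => g (t *: v + x)) \o shift s) (h *: 1) - g (s *: v + x))).
Proof. by apply/funext => h; rewrite /dquot addrA -scalerDl /= [h *: 1]mulr1. Qed.

Lemma derivable_line g v x (s : R) :
  derivable g (s *: v + x) v <-> derivable (fun t : R => g (t *: v + x)) s 1.
Proof. by rewrite derivable_dquot dquot_line. Qed.

Lemma derive_line g v x (s : R) :
  derive g (s *: v + x) v = derive (fun t : R => g (t *: v + x)) s 1.
Proof. by rewrite derive_dquot dquot_line. Qed.

Lemma is_derive_line g v x (s l : R) :
  is_derive (s *: v + x) v g l <-> is_derive s 1 (fun t : R => g (t *: v + x)) l.
Proof.
split=> -[h1 h2]; split.
- exact/derivable_line.
- by rewrite -derive_line.
- exact/derivable_line.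
- by rewrite derive_line.
Qed.

End difference_quotient.

Section directional_lipschitz.
Variables (R : realType) (k : nat) (g : 'rV[R]_k -> R) (v : 'rV[R]_k) (L : R).
Hypothesis cg : continuous g.
Hypothesis Lg : forall x (h : R), `|g (h *: v + x) - g x| <= L * `|h|.
Local Notation leb := (@lebesgue_measure R).
Local Notation mR := (measurableTypeR R).
Local Notation mu := (lebesgue_rV R k).

Let L_ge0 : 0 <= L.
Proof. by have := Lg 0 1; rewrite normr1 mulr1; apply: le_trans. Qed.

Lemma dquot_le x (h : R) : `|dquot g v x h| <= L.
Proof.
rewrite /dquot normrM normfV; have [->|h0] := eqVneq h 0; first by rewrite normr0 invr0 mul0r.
by rewrite ler_pdivrMl ?normr_gt0// mulrC.
Qed.

Lemma continuous_dquot (h : R) : continuous (fun x => dquot g v x h).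
Proof.
move=> x; apply: (@contM R 'rV[R]_k (fun=> h^-1) (fun x => g (h *: v + x) - g x)); first exact: cont_cst.
apply: (@contB R 'rV[R]_k (fun x => g (h *: v + x)) g); last exact: cg.
apply: (@continuous_comp 'rV[R]_k 'rV[R]_k R (fun y => h *: v + y) g); last exact: cg.
exact: cont_shift.
Qed.

(* Differentiability as a Cauchy criterion over all real increments, so that only closed
   sets occur in the countable operations. *)
Let C (n m : nat) : set 'rV[R]_k := \bigcap_(p in [set p : R * R |
    [/\ p.1 != 0, p.2 != 0, `|p.1| < m.+1%:R^-1 & `|p.2| < m.+1%:R^-1]])
  [set x | `|dquot g v x p.1 - dquot g v x p.2| <= n.+1%:R^-1].

Let closed_C n m : closed (C n m).
Proof.
apply: closed_bigI => p _.
have cf : continuous (fun x => `|dquot g v x p.1 - dquot g v x p.2|).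
  move=> x; apply: (@cont_norm R 'rV[R]_k (fun x => dquot g v x p.1 - dquot g v x p.2)).
  by apply: (@contB R 'rV[R]_k (dquot g v ^~ p.1) (dquot g v ^~ p.2)); exact: continuous_dquot.
exact: (preimage_closed (fun x _ => cf x) (@closed_le R _)).
Qed.

Let derivable_C : [set x | derivable g x v] = \bigcap_n \bigcup_m C n m.
Proof.
apply/seteqP; split=> x /=.
  rewrite derivable_dquot => /cvg_ex[l /cvg_dnbhs0P H] n _.
  have [|d d0 hd] := H (n.+1%:R^-1 / 2); first by rewrite divr_gt0// invr_gt0 ltr0n.
  have [m md] : exists m : nat, m.+1%:R^-1 < d.
    exists (Num.bound d^-1); rewrite invf_plt ?posrE ?ltr0n//.
    rewrite (lt_trans (archi_boundP _))// ?invr_ge0 ?ltW// ltr_nat; exact: leqnn.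
  exists m => // -[h h'] /= [h0 h'0 hm h'm].
  have e1 := hd h h0 (lt_trans hm md); have e2 := hd h' h'0 (lt_trans h'm md).
  rewrite -(subrK l (dquot g v x h)) -addrA (le_trans (ler_normD _ _))// distrC.
  by rewrite [leRHS]splitr lerD.
move=> H; rewrite derivable_dquot; apply/cauchy_cvgP/cauchy_ballP => e e0.
have [n ne] : exists n : nat, n.+1%:R^-1 < e.
  exists (Num.bound e^-1); rewrite invf_plt ?posrE ?ltr0n//.
  rewrite (lt_trans (archi_boundP _))// ?invr_ge0 ?ltW// ltr_nat; exact: leqnn.
have [m _ Cm] := H n I.
have near_h : \forall h \near (0 : R)^', h != 0 /\ `|h| < m.+1%:R^-1.
  near=> h; split; first by near: h; exact: nbhs_dnbhs_neq.
  by near: h; apply: dnbhs0_lt; rewrite invr_gt0 ltr0n.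
exists (dquot g v x @` [set h | h != 0 /\ `|h| < m.+1%:R^-1],
        dquot g v x @` [set h | h != 0 /\ `|h| < m.+1%:R^-1]) => /=.
  by split; (apply: filterS near_h => h hh /=; exists h).
move=> [y y'] /= [[h [h0 hm] <-] [h' [h'0 h'm] <-]].
by apply: le_lt_trans ne; exact: (Cm (h, h')).
Unshelve. all: by end_near. Qed.

Lemma measurable_derivable : measurable [set x | derivable g x v].
Proof.
rewrite derivable_C; apply: bigcapT_measurable => n; apply: bigcupT_measurable => m.
apply: closed_measurable_rV; exact: closed_C.
Qed.

(** Along a sequence of increments the derivative is a pointwise limit of continuous functions, as
    required for its measurability and for dominated convergence. *)
Lemma cvg_dquot_seq x : derivable g x v ->
  dquot g v x n.+1%:R^-1 @[n --> \oo] --> derive g x v.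
Proof.
move=> dg; have H : dquot g v x h @[h --> 0^'] --> derive g x v by exact: dg.
apply/cvgrPdist_le => e e0; have [d d0 hd] := (cvg_dnbhs0P _ _).1 H e e0.
near=> n; apply: hd; first by rewrite invr_neq0// pnatr_eq0.
rewrite ger0_norm ?invr_ge0//; near: n.
exact: (near_infty_natSinv_lt (PosNum d0)).
Unshelve. all: by end_near. Qed.

Lemma measurable_derive : measurable_fun setT (fun x => derive g x v).
Proof.
rewrite -(setUv [set x | derivable g x v]).
apply: (measurable_funU _ measurable_derivable (measurableC measurable_derivable)).2.
split.
  apply: (@measurable_fun_cvg _ _ _ _ (fun n x => dquot g v x n.+1%:R^-1)).
    move=> n; apply: measurable_funTS; apply: continuous_measurable_rV.
    exact: continuous_dquot.
  by move=> x /= dx; exact: cvg_dquot_seq.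
apply: (eq_measurable_fun (cst point)) => // x /[!inE] /= ndx.
by rewrite derive_dquot dvgP.
Qed.

(** Where the limit does not exist, [derive] takes the default value [point] of [lim]; this is the
    origin of the second term. *)
Lemma derive_bounded x : `|derive g x v| <= L + `|point : R|.
Proof.
have [dx|ndx] := pselect (derivable g x v); last first.
  by rewrite derive_dquot dvgP// lerDr.
rewrite (le_trans _ (_ : L <= _)) ?lerDl//.
have /cvg_dnbhs0P H : dquot g v x h @[h --> 0^'] --> derive g x v by exact: dx.
apply/ler_addgt0Pr => e e0; have [d d0 hd] := H e e0.
have d2 : 0 < d / 2 by rewrite divr_gt0.
rewrite -(subrK (dquot g v x (d / 2)) (derive g x v)) (le_trans (ler_normD _ _))//.
rewrite addrC lerD ?dquot_le ?hd ?gt_eqF// ger0_norm ?ltW//.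
by rewrite ltr_pdivrMr// ltr_pMr// ltr1n.
Qed.

Let measurable_line : measurable_fun setT (fun p : mR * 'rV[R]_k => (p.1 : R) *: v + p.2).
Proof.
apply/measurable_fun_rVP => i; under eq_fun do rewrite !mxE.
apply: measurable_funD; last exact: (measurableT_comp (measurable_coord i) measurable_snd).
by apply: measurable_funM => //; exact: (@measurable_fst _ _ mR).
Qed.

Let measurable_nd_line x : measurable [set s : mR | ~ derivable g ((s : R) *: v + x) v].
Proof.
rewrite (_ : mkset _ = ~` ((fun s : mR => (s : R) *: v + x) @^-1` [set y | derivable g y v])); last by [].
apply: measurableC; rewrite -[X in measurable X]setTI.
apply: (measurableT_comp measurable_line (measurable_pair2 x)) => //.
exact: measurable_derivable.
Qed.

Let nd_line x : leb [set s : mR | ~ derivable g ((s : R) *: v + x) v] = 0%E.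
Proof.
have Lx : forall s t : R, `|g (s *: v + x) - g (t *: v + x)| <= L * `|s - t|.
  move=> s t; have := Lg (t *: v + x) (s - t).
  by rewrite addrA -scalerDl subrK.
have [N [mN N0 subN]] := lipschitz_ae_derivable Lx.
apply/eqP; rewrite eq_le measure_ge0 andbT -N0.
apply: le_measure; [apply: mem_set|exact: mem_set|].
  exact: measurable_nd_line.
by move=> s /= ns; apply: subN => /= ds; apply: ns; exact/derivable_line.
Qed.

(* By Tonelli and translation invariance, the measure of the exceptional set is the
   integral over [x] of the measure of its trace on the segment [x, x + v]. *)
Lemma nonderivable_null : mu [set x | ~ derivable g x v] = 0%E.
Proof.
set N := mkset _.
have mN : measurable N by apply: measurableC; exact: measurable_derivable.
pose f (p : mR * 'rV[R]_k) : \bar R :=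
  ((\1_(`[0, 1]%classic : set R) (p.1 : R) : R) * \1_N ((p.1 : R) *: v + p.2))%:E.
have mf : measurable_fun setT f.
  apply/measurable_EFinP; apply: measurable_funM.
    apply: (@measurableT_comp _ _ _ _ mR R (\1_(`[0, 1]%classic : set mR)) _ fst).
      exact: (@measurable_indic _ mR).
    exact: measurable_fst.
  apply: (@measurableT_comp _ _ _ _ 'rV[R]_k R (\1_N) _ (fun p => (p.1 : R) *: v + p.2)).
    exact: measurable_indic.
  exact: measurable_line.
have f0 p : (0 <= f p)%E by rewrite lee_fin mulr_ge0.
have := @fubini_tonelli _ _ _ _ R leb mu f mf f0.
rewrite [RHS]integral0_eq; last first.
  move=> x _; apply/eqP; rewrite eq_le integral_ge0 ?andbT//.
  have <- : (\int[leb]_s (\1_[set s : mR | ~ derivable g ((s : R) *: v + x) v] s)%:E = 0)%E.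
    have mS := measurable_nd_line x.
    by rewrite integral_indic// setIT; exact: nd_line.
  apply: ge0_le_integral => //.
  - exact: (measurableT_comp mf (measurable_pair2 _)).
  - by apply/measurable_EFinP; apply: measurable_indic; exact: measurable_nd_line.
  - move=> s _; rewrite lee_fin !indicE/=.
    have [|_] := boolP (_ \in N); last by rewrite mulr0.
    move=> /set_mem Ns.
    have -> : s \in [set s0 : mR | ~ derivable g ((s0 : R) *: v + x) v] = true by exact: mem_set.
    by case: (s \in `[0, 1]%classic); rewrite ?mul0r ?mulr1.
rewrite (eq_integral (fun s : mR => (\1_(`[0, 1]%classic : set mR) s)%:E * mu N)%E); last first.
  move=> s _; rewrite /f.
  under eq_integral do rewrite EFinM/=.
  rewrite ge0_integralZl//; last first.
  - apply/measurable_EFinP; apply: (@measurableT_comp _ _ _ _ 'rV[R]_k R (\1_N) _ (fun y => (s : R) *: v + y)).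
      exact: measurable_indic.
    exact: (measurableT_comp measurable_line (measurable_pair1 s)).
  congr (_ * _)%E; under eq_integral do rewrite addrC.
  rewrite (ge0_integral_translate _ (f := EFin \o \1_N))//.
  - by rewrite integral_indic ?setIT.
  - by apply/measurable_EFinP.
  - by move=> x; rewrite lee_fin.
have mI : measurable_fun setT (fun s : mR => (\1_(`[0, 1]%classic : set mR) s)%:E : \bar R).
  by apply/measurable_EFinP; exact: (@measurable_indic _ mR).
rewrite ge0_integralZr//.
rewrite integral_indic ?setIT//.
rewrite [X in (X * _)%E](_ : _ = 1%E) ?mul1e//.
rewrite [LHS]lebesgue_measure_itv/= lte_fin ltr01 oppr0 adde0//.
Qed.

Lemma ae_derivable : {ae mu, forall x, derivable g x v}.
Proof.
exists [set x | ~ derivable g x v]; split => //.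
- apply: measurableC; exact: measurable_derivable.
- exact: nonderivable_null.
Qed.

End directional_lipschitz.

(** * Directional derivatives of compactly supported functions have integral zero *)

Section integral_derive.
Variables (R : realType) (k : nat).
Local Notation mu := (lebesgue_rV R k).
Implicit Types (g : 'rV[R]_k -> R) (v : 'rV[R]_k) (L : R).

Lemma lebesgue_rV_translate v (A : set 'rV[R]_k) : measurable A ->
  mu [set x | A (x + v)] = mu A.
Proof.
move=> mA.
have E B : measurable B -> mu B = (\int[mu]_x (\1_B x)%:E)%E.
  by move=> mB; rewrite integral_indic ?setIT.
have mA' : measurable [set x | A (x + v)].
  by rewrite -[X in measurable X]setTI; exact: measurable_translate.
rewrite E// [RHS]E// -(ge0_integral_translate v (f := EFin \o \1_A)).
- by apply: eq_integral => x _; rewrite /= !indicE.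
- by apply/measurable_EFinP.
- by move=> x; rewrite lee_fin.
Qed.

Lemma bms_translate g v : bms g -> bms (fun x => g (x + v)).
Proof.
move=> [mg [M gM] [r gr]]; split.
- exact: measurableT_comp mg (measurable_translate v).
- by exists M => x.
- exists (r + `|v|) => x rx; apply: gr.
  have : `|x| <= `|x + v| + `|v|.
    by rewrite -{1}(addrK v x) (le_trans (ler_normB _ _)).
  by move=> H; have := le_trans rx H; rewrite lerD2r.
Qed.

Lemma bms_integral_translate g v : bms g ->
  (\int[mu]_x (g (x + v))%:E = \int[mu]_x (g x)%:E)%E.
Proof.
move=> bg; have ig := bms_integrable bg.
have [mg _ _] := bg.
have mt := measurable_translate v.
have igt : mu.-integrable setT (EFin \o g \o (fun x => x + v)).
  apply/integrableP; split; first exact/measurable_EFinP/measurableT_comp.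
  rewrite (ge0_integral_translate v (f := fun x => `|(g x)%:E|%E))//.
    by case/integrableP : ig.
  by apply: measurableT_comp => //; exact/measurable_EFinP.
transitivity (\int[pushforward mu (fun x => (x + v)%R)]_y (EFin \o g) y)%E.
  by rewrite integral_pushforward//; exact/measurable_EFinP.
apply: eq_measure_integral => A mA _; exact: lebesgue_rV_translate.
Qed.

Section compact_support.
Variables (g : 'rV[R]_k -> R) (v : 'rV[R]_k) (L : R).
Hypothesis cg : continuous g.
Hypothesis Lg : forall x (h : R), `|g (h *: v + x) - g x| <= L * `|h|.
Hypothesis sg : exists r : R, forall x, r <= `|x| -> g x = 0.

Let L_ge0 : 0 <= L.
Proof. by have := Lg 0 1; rewrite normr1 mulr1; apply: le_trans. Qed.

(** The radius grows by [|v|], so that for [|h| <= 1] both points of the quotient lie outside the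
    support of [g]. *)
Lemma dquot_support : exists r : R, forall x, r <= `|x| -> forall h, `|h| <= 1 -> dquot g v x h = 0.
Proof.
have [r gr] := sg; exists (r + `|v|) => x rx h h1; rewrite /dquot !gr ?subrr ?mulr0//.
  by rewrite (le_trans _ rx)// lerDl.
have : `|x| <= `|h *: v + x| + `|v|.
  rewrite -{1}(addKr (h *: v) x) (le_trans (ler_normD _ _))// normrN addrC lerD2l.
  by rewrite normrZ ler_piMl.
move=> H; have := le_trans rx H; by rewrite lerD2r.
Qed.

Lemma bms_derive : bms (fun x => derive g x v).
Proof.
split; first by apply: measurable_derive.
  by exists (L + `|point : R|) => x; exact: (derive_bounded Lg).
have [r hr] := dquot_support; exists r => x rx; rewrite derive_dquot.
apply/cvg_lim => //; apply/cvg_dnbhs0P => e e0; exists 1 => // h _ h1.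
by rewrite hr ?subrr ?normr0// ltW.
Qed.

(** The two terms of a difference quotient have the same integral by translation invariance. The
    quotients are bounded by [L] and vanish outside one ball, so the dominated convergence theorem
    applies. *)
Lemma integral_derive_eq0 : bms g -> (\int[mu]_x (derive g x v)%:E = 0)%E.
Proof.
move=> bg.
have [r hr] := dquot_support.
pose B : set 'rV[R]_k := ball 0 (`|r| + 1).
have r1 : 0 < `|r| + 1 by rewrite ltr_wpDl.
have /andP[_ B_fin] := lebesgue_rV_ball (0 : 'rV[R]_k) r1.
have mB : measurable B by exact: measurable_ball_rV.
have sB x : ~ B x -> forall h, `|h| <= 1 -> dquot g v x h = 0.
  move=> Bx; apply: hr; rewrite leNgt; apply/negP => xr; apply: Bx.
  rewrite /B mx_norm_ball /ball_/= sub0r normrN (lt_le_trans xr)//.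
  by rewrite (le_trans (ler_norm r))// lerDl.
pose q n x : \bar R := (dquot g v x n.+1%:R^-1)%:E.
have mq n : measurable_fun setT (q n).
  apply/measurable_EFinP; apply: continuous_measurable_rV; exact: continuous_dquot.
have [d0 md0 sd0] := bms_derive.
have n1 n : `|n.+1%:R^-1 : R| <= 1 by rewrite ger0_norm ?invr_ge0// invf_le1 ?ltr0n// ler1n.
have [||||_ _ H] := @dominated_convergence _ _ R mu setT measurableT q
  (fun x => (derive g x v)%:E) (fun x => (L * \1_B x)%:E) mq.
- exact/measurable_EFinP.
- have [N [mN N0 sN]] := ae_derivable cg Lg; exists N; split => // x hx.
  apply: sN => dx; apply: hx => /= _; apply: cvg_EFin; first by near=> n.
  exact: (cvg_dquot_seq dx).
- have -> : (fun x => (L * \1_B x)%:E) = (fun x => L%:E * (\1_B x)%:E)%E by [].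
  apply: integrableZl => //; apply: (@bms_integrable _ _ (\1_B)); split.
  + exact: measurable_indic.
  + by exists 1 => x; rewrite indicE; case: (_ \in _); rewrite ?normr1 ?normr0.
  + exists (`|r| + 1) => x xr; rewrite indicE memNset// => -[_ xB].
    move: xr; rewrite leNgt => /negP; apply.
    have : B x by []. rewrite /B mx_norm_ball /ball_/= sub0r normrN; exact.
- apply: aeW => x n _; rewrite lee_fin indicE.
  have [Bx|Bx] := boolP (x \in B); first by rewrite mulr1; exact: dquot_le.
  by rewrite sB ?normr0 ?mulr0//; rewrite notin_setE in Bx.
have q0 n : (\int[mu]_x q n x = 0)%E.
  rewrite /q /dquot.
  have ig := bms_integrable bg.
  have igt : mu.-integrable setT (fun x => (g (n.+1%:R^-1 *: v + x))%:E).
    rewrite (_ : (fun _ => _) = EFin \o (fun x => g (x + n.+1%:R^-1 *: v))).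
      exact/bms_integrable/bms_translate.
    by apply/funext => x; rewrite /= addrC.
  under eq_integral do rewrite EFinM EFinB.
  rewrite (@integralZl _ _ _ mu setT measurableT _ (integrableB measurableT igt ig)).
  rewrite integralB//; under eq_integral do rewrite addrC.
  rewrite bms_integral_translate// subee ?mule0//.
  exact: integrable_fin_num.
have : [sequence (\int[mu]_x q n x)%E]_n @ \oo --> 0%E.
  rewrite (_ : [sequence _]_n = cst 0%E); first exact: cvg_cst.
  by apply/funext => n; exact: q0.
move/cvg_unique : H => /[apply] -> //.
Unshelve. all: by end_near. Qed.

End compact_support.
End integral_derive.

(** * Euclidean norm and the convex integrand *)

Section enorm.
Variables (R : realType) (k : nat).
Implicit Types p q v : 'rV[R]_k.

Lemma enorm_ge0 v : 0 <= enorm v.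
Proof. exact: sqrtr_ge0. Qed.

Lemma sqr_enorm v : enorm v ^+ 2 = \sum_i v 0 i ^+ 2.
Proof. by rewrite sqr_sqrtr// sumr_ge0// => i _; exact: sqr_ge0. Qed.

Lemma norm_le_enorm v : `|v| <= enorm v.
Proof.
apply: rV_norm_le; first exact: enorm_ge0.
move=> i; rewrite -(ler_pXn2r (n := 2)) ?nnegrE ?enorm_ge0//.
rewrite sqr_enorm real_normK ?num_real// (bigD1 i)//= lerDl.
by apply: sumr_ge0 => j _; exact: sqr_ge0.
Qed.

(** The crude constant [k.+1] dominates the sharp one, the square root of [k], and is positive in
    every dimension. *)
Lemma enorm_le_norm v : enorm v <= k.+1%:R * `|v|.
Proof.
have h0 : 0 <= k.+1%:R * `|v| by rewrite mulr_ge0.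
rewrite -(ler_pXn2r (n := 2))// ?nnegrE ?enorm_ge0// sqr_enorm.
apply: (@le_trans _ _ (\sum_(i < k) `|v| ^+ 2)).
  apply: ler_sum => i _; rewrite -(real_normK (num_real (v 0 i))).
  by rewrite ler_pXn2r ?nnegrE ?coord_le_norm.
rewrite sumr_const card_ord -[leLHS]mulr_natl exprMn ler_wpM2r ?sqr_ge0//.
rewrite -natrX ler_nat; apply: (leq_trans (leqnSn k)).
by rewrite expnS leq_pmulr// expn_gt0.
Qed.

Lemma enorm_eq0 v : enorm v = 0 -> v = 0.
Proof. by move=> v0; apply/eqP; rewrite -normr_le0 -v0; exact: norm_le_enorm. Qed.

Lemma enorm0 : enorm (0 : 'rV[R]_k) = 0.
Proof.
by apply/eqP; rewrite eq_le enorm_ge0 andbT (le_trans (enorm_le_norm _))// normr0 mulr0.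
Qed.

Lemma cauchy_schwarz p q : \sum_i p 0 i * q 0 i <= enorm p * enorm q.
Proof.
have := enorm_ge0 p; rewrite le_eqVlt => /orP[/eqP p0|a0].
  by rewrite -p0 mul0r (enorm_eq0 (esym p0)) big1// => i _; rewrite mxE mul0r.
have := enorm_ge0 q; rewrite le_eqVlt => /orP[/eqP q0|b0].
  by rewrite -q0 mulr0 (enorm_eq0 (esym q0)) big1// => i _; rewrite mxE mulr0.
set a := enorm p in a0 *; set b := enorm q in b0 *; set S := \sum_i _.
(* This sum equals [2 * a * b * (a * b - S)]. *)
have : 0 <= \sum_i (b * p 0 i - a * q 0 i) ^+ 2.
  by apply: sumr_ge0 => i _; exact: sqr_ge0.
have -> : \sum_i (b * p 0 i - a * q 0 i) ^+ 2 =
    b ^+ 2 * \sum_i p 0 i ^+ 2 + a ^+ 2 * \sum_i q 0 i ^+ 2 - 2 * a * b * S.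
  rewrite /S !mulr_sumr -big_split/= -sumrB; apply: eq_bigr => i _; ring.
rewrite -!sqr_enorm -/a -/b => h.
have ab : 0 < a * b by rewrite mulr_gt0.
rewrite -(ler_pM2l ab); nra.
Qed.

End enorm.

Section derivative1.
Variable R : realType.
Implicit Types f g : R -> R.

Lemma is_derive1_epsP f (a l : R) : is_derive a 1 f l -> forall e, 0 < e ->
  exists2 d, 0 < d & forall h, h != 0 -> `|h| < d -> `|l - h^-1 * (f (h + a) - f a)| <= e.
Proof.
move=> [df <-]; have : h^-1 * (f (h + a) - f a) @[h --> 0^'] --> derive f a 1.
  rewrite (_ : (fun h => h^-1 * (f (h + a) - f a)) =
    (fun h => h^-1 *: ((f \o shift a) (h *: 1) - f a))); first exact: df.
  by apply/funext => h /=; rewrite [h *: 1]mulr1.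
by move/cvg_dnbhs0P.
Qed.

Lemma lipschitz_of_derive f (df : R -> R) (a b C : R) :
  (forall t, Num.min a b <= t <= Num.max a b -> is_derive t 1 f (df t) /\ `|df t| <= C) ->
  `|f b - f a| <= C * `|b - a|.
Proof.
wlog ab : a b / a <= b.
  move=> H h; have [|/ltW ba] := leP a b; first by move=> ab; exact: H.
  by rewrite distrC (distrC b); apply: H => // t; rewrite minC maxC; exact: h.
rewrite min_l// max_r// => h.
have [||c cab ->] := @MVT_segment R f df a b ab.
- by move=> t; rewrite in_itv/= => /andP[/ltW at_ /ltW tb]; apply: (h t _).1; rewrite at_.
- apply: derivable_within_continuous => t; rewrite in_itv/= => tab.
  by have [[dt _] _] := h t tab.
by rewrite normrM ler_wpM2r//; apply: (h c _).2; move: cab; rewrite in_itv.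
Qed.

End derivative1.

Section convex_integrand.
Variables (R : realType) (sigma : R) (f df d2f : R -> R).
Hypothesis Hf : standingA sigma f df d2f.

(** Convexity bounds the increment of [f] over the fraction [t] of the segment by [t * (f b - f a)];
    a small [t] turns it into the derivative. At [a = 0], where the derivative is one-sided,
    [df 0 = 0] and monotonicity give the claim directly. *)
Lemma convex_tangent (a b : R) : 0 <= a -> 0 <= b -> df a * (b - a) <= f b - f a.
Proof.
case: Hf => s0 [cf [nf [[_ [Df _]] [_ [_ [_ [df0 _]]]]]]] a0 b0.
move: a0; rewrite le_eqVlt => /orP[/eqP <-|a0].
  rewrite df0; last by rewrite lexx ltW.
  by rewrite mul0r subr_ge0; apply: nf; rewrite lexx.
have [->|ba] := eqVneq b a; first by rewrite !subrr mulr0.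
have c0 : 0 < `|b - a| by rewrite normr_gt0 subr_eq0.
apply/ler_addgt0Pr => e e0.
have [d d0 hd] := is_derive1_epsP (Df a a0) (divr_gt0 e0 c0).
(* The increment [t * (b - a)] must be shorter than [d], and [t] at most [1]. The tolerance
   [e / |b - a|] becomes [e] once multiplied by [|b - a|]. *)
pose t := Num.min (1 / 2) (d / (2 * `|b - a|)).
have t0 : 0 < t by rewrite lt_min !divr_gt0// mulr_gt0.
have t1 : t <= 1 / 2 by rewrite ge_min lexx.
have td : t * `|b - a| < d.
  apply: (@le_lt_trans _ _ (d / (2 * `|b - a|) * `|b - a|)).
    by rewrite ler_pM2r// ge_min lexx orbT.
  rewrite (_ : _ * _ = d / 2); first by rewrite ltr_pdivrMr// ltr_pMr// ltr1n.
  by field; rewrite gt_eqF.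
have h0 : t * (b - a) != 0 by apply: mulf_neq0; [rewrite gt_eqF|rewrite subr_eq0].
have := hd _ h0; rewrite normrM (gtr0_norm t0) => /(_ td).
have := cf b a t b0 (ltW a0); rewrite ltW//= => /(_ (ltac:(by lra))).
have -> : t * b + (1 - t) * a = t * (b - a) + a by ring.
set F := f (_ + a) => cF.
have E : (t * (b - a))^-1 * (F - f a) * (b - a) = (F - f a) / t.
  by field; rewrite gt_eqF//= subr_eq0.
have Fle : (F - f a) / t <= f b - f a by rewrite ler_pdivrMr//; lra.
set Q := _^-1 * _ in E * => hQ.
have : (df a - Q) * (b - a) <= e.
  apply: (le_trans (ler_norm _)); rewrite normrM.
  by rewrite -ler_pdivlMr.
by rewrite mulrBl E; lra.
Qed.

Lemma df_ge0 (a : R) : 0 <= a -> 0 <= df a.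
Proof.
move=> a0; have h := convex_tangent a0 (lexx 0).
case: Hf => s0 [cf [nf [_ [_ [_ [_ [df0 _]]]]]]].
move: (a0); rewrite le_eqVlt => /orP[/eqP <-|a1]; first by rewrite df0// lexx ltW.
have h2 : f 0 <= f a by apply: nf; rewrite lexx.
have : 0 <= df a * a by lra.
by rewrite pmulr_lge0.
Qed.

(** The flux is the gradient of the convex function [f \o enorm]. The tangent inequality of [f]
    passes to it by Cauchy-Schwarz, because [df] is nonnegative. *)
Lemma flux_monotone k (p q : 'rV[R]_k) :
  \sum_i (df (enorm p) / enorm p * p 0 i) * (q 0 i - p 0 i) <= f (enorm q) - f (enorm p).
Proof.
have h := convex_tangent (enorm_ge0 p) (enorm_ge0 q).
have d0 := df_ge0 (enorm_ge0 p).
have := enorm_ge0 p; rewrite le_eqVlt => /orP[/eqP p0|p0].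
  (* Since [0^-1 = 0], the flux is zero at [p = 0], where [f \o enorm] is minimal. *)
  rewrite -p0 invr0 mulr0 big1 => [|i _]; last by rewrite !mul0r.
  case: Hf => s0 [cf [nf _]]; rewrite subr_ge0; apply: nf; by rewrite lexx enorm_ge0.
apply: le_trans h.
have -> : \sum_i (df (enorm p) / enorm p * p 0 i) * (q 0 i - p 0 i) =
   df (enorm p) / enorm p * (\sum_i p 0 i * q 0 i - \sum_i p 0 i ^+ 2).
  by rewrite mulrBr !mulr_sumr -sumrB; apply: eq_bigr => i _; ring.
have -> : df (enorm p) * (enorm q - enorm p) =
   df (enorm p) / enorm p * (enorm p * enorm q - enorm p ^+ 2).
  by field; rewrite gt_eqF.
rewrite -sqr_enorm ler_wpM2l ?divr_ge0 ?enorm_ge0// lerD2r; exact: cauchy_schwarz.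
Qed.

End convex_integrand.

Section flux_derivative.
Variables (R : realType) (df d2f : R -> R).
Hypothesis Hdf : C2_pos df d2f.

(** With these coefficients the flux [P |-> coef2 |P| P] has Jacobian
    [coef1 |P| P^T P + coef2 |P| I] for row vectors [P != 0], whose contraction appears in [Gop]. *)
Definition coef1 (s : R) : R := (s * d2f s - df s) / s ^+ 3.
Definition coef2 (s : R) : R := df s / s.

Lemma is_derive_coef2 (s : R) : 0 < s -> is_derive s 1 coef2 (s * coef1 s).
Proof.
move=> s0; have [D _] := Hdf s0.
have s1 : s != 0 by rewrite gt_eqF.
have I : is_derive s 1 (fun t : R => t^-1) (- s ^- 2).
  apply: is_derive_eq; first exact: (is_deriveV (f := id) (x := s) (v := 1)).
  by rewrite /= scaler1.
have H : is_derive s 1 coef2 (df s *: (- s ^- 2) + s^-1 *: d2f s) := is_deriveM D I.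
apply: is_derive_eq H _.
rewrite /coef1 /GRing.scale/=; field; exact: s1.
Qed.

(** Chain rule along a curve [p]: the factor [s] in the derivative of [coef2] cancels the [1 / N t]
    from the derivative of the norm. *)
Lemma flux_derive1 m (p : 'I_m -> R -> R) (dp : 'I_m -> R) (t : R) (i : 'I_m) :
  (forall j, is_derive t 1 (p j) (dp j)) ->
  let N := fun s => Num.sqrt (\sum_j p j s ^+ 2) in 0 < N t ->
  is_derive t 1 (fun s => coef2 (N s) * p i s)
    (coef1 (N t) * (\sum_j p j t * dp j) * p i t + coef2 (N t) * dp i).
Proof.
move=> Dp N Nt.
have S0 : 0 < \sum_j p j t ^+ 2 by rewrite -sqrtr_gt0.
have DS : is_derive t 1 (fun s => \sum_j p j s ^+ 2) (\sum_j 2 * p j t * dp j).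
  rewrite (_ : (fun s => _) = \sum_j (p j ^+ 2)); last first.
    by apply/funext => s; rewrite fct_sumE; apply: eq_bigr => j _; rewrite exprfctE.
  apply: (is_derive_eq (@is_derive_sum R R R m (fun j => p j ^+ 2) t 1
    (fun j => (2%:R * p j t ^+ 1) *: dp j) (fun j => is_deriveX 2 (Dp j)))).
  by apply: eq_bigr => j _; rewrite /GRing.scale/= expr1.
have DN : is_derive t 1 N ((2 * N t)^-1 * \sum_j 2 * p j t * dp j).
  exact: (is_derive1_comp (is_derive1_sqrt S0) DS).
have D2 : is_derive t 1 (coef2 \o N) (N t * coef1 (N t) * ((2 * N t)^-1 * \sum_j 2 * p j t * dp j)).
  exact: (is_derive1_comp (is_derive_coef2 Nt) DN).
have H : is_derive t 1 (fun s => coef2 (N s) * p i s) (_ *: dp i + p i t *: _) := is_deriveM D2 (Dp i).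
apply: is_derive_eq H _.
rewrite /GRing.scale/=.
have -> : \sum_j 2 * p j t * dp j = 2 * \sum_j p j t * dp j.
  by rewrite mulr_sumr; apply: eq_bigr => j _; rewrite mulrA.
field; by rewrite gt_eqF.
Qed.

End flux_derivative.

(** * Closed boxes and Lipschitz bounds from partial derivatives *)

Lemma cont_dist (R : realType) (V : normedModType R) (a : V) : continuous (fun x : V => `|x - a|).
Proof.
move=> x; apply: cvg_norm; apply: cvgB; [exact: cvg_id|exact: cvg_cst].
Qed.

Section box.
Variables (R : realType) (k : nat).
Implicit Types (a x y : 'rV[R]_k) (g : 'rV[R]_k -> R).

(** For the sup norm a closed ball is a product of intervals, so exchanging coordinates between two
    of its points does not leave it. *)
Definition cbox (a : 'rV[R]_k) (r : R) : set 'rV[R]_k := [set x | `|x - a| <= r].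

Lemma compact_cbox a r : compact (cbox a r).
Proof.
apply: bounded_closed_compact.
  exists (`|a| + r); split; first exact: num_real.
  move=> M hM x /= xr; apply: (@le_trans _ _ (`|a| + r)); last exact: ltW.
  by rewrite -(subrK a x) (le_trans (ler_normD _ _))// addrC lerD2l.
have cf : continuous (fun x : 'rV[R]_k => `|x - a|) by exact: cont_dist.
exact: (preimage_closed (fun x _ => cf x) (@closed_le R r)).
Qed.

Lemma cbox_coord a r x i : cbox a r x -> `|x 0 i - a 0 i| <= r.
Proof. by move=> h; have := coord_le_norm (x - a) i; rewrite !mxE; move/le_trans; exact. Qed.

Lemma cboxP a r x : 0 <= r -> (forall i, `|x 0 i - a 0 i| <= r) -> cbox a r x.
Proof. by move=> r0 h; apply: rV_norm_le => // i; rewrite !mxE. Qed.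

Lemma cbox_line a r x i (h t : R) : cbox a r x -> cbox a r (h *: evec R i + x) ->
  Num.min 0 h <= t <= Num.max 0 h -> cbox a r (t *: evec R i + x).
Proof.
move=> bx bh th; have r0 : 0 <= r by apply: le_trans bx.
apply: cboxP => // j; have := cbox_coord j bx; have := cbox_coord j bh.
rewrite !mxE eqxx /=; case: eqP => _; rewrite ?mulr1 ?mulr0 ?add0r//.
rewrite !ler_norml; move: th; rewrite ge_min le_max.
by case: (leP 0 h); case: (leP h 0) => ? ? /andP[/orP[] ? /orP[] ?] /andP[? ?] /andP[? ?]; apply/andP; split; lra.
Qed.

Lemma box_coord_lip a r g (C : R) i :
  (forall x, cbox a r x -> derivable g x (evec R i) /\ `|derive g x (evec R i)| <= C) ->
  forall x (h : R), cbox a r x -> cbox a r (h *: evec R i + x) ->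
  `|g (h *: evec R i + x) - g x| <= C * `|h|.
Proof.
move=> hg x h bx bh.
have := @lipschitz_of_derive R (fun t => g (t *: evec R i + x))
  (fun t => derive g (t *: evec R i + x) (evec R i)) 0 h C.
rewrite scale0r add0r subr0; apply => t th.
have [d1 d2] := hg _ (cbox_line bx bh th); split; last exact: d2.
by apply/is_derive_line; exact: DeriveDef.
Qed.

(** The points [z n] lead from [y] to [x] inside the box, changing one coordinate at a time; each of
    the [k] moves costs at most [C * |x - y|]. *)
Lemma box_lip a r g (C : R) :
  (forall i x, cbox a r x -> derivable g x (evec R i) /\ `|derive g x (evec R i)| <= C) ->
  forall x y, cbox a r x -> cbox a r y -> `|g x - g y| <= k%:R * C * `|x - y|.
Proof.
move=> hg x y bx byy; have r0 : 0 <= r by apply: le_trans bx.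
have [k0|k0] := posnP k.
  have -> : x = y by apply/rowP => j; have := ltn_ord j; rewrite [X in (_ < X)%N -> _]k0.
  by rewrite !subrr !normr0 mulr0.
have C0 : 0 <= C by have [_] := hg (Ordinal k0) x bx; apply: le_trans.
pose z n : 'rV[R]_k := \row_j (if (j < n)%N then x 0 j else y 0 j).
have bz n : cbox a r (z n).
  by apply: cboxP => // j; rewrite mxE; case: ifP => _; exact: cbox_coord.
suff H n : (n <= k)%N -> `|g (z n) - g y| <= n%:R * (C * `|x - y|).
  have zk : z k = x by apply/rowP => j; rewrite mxE ltn_ord.
  by rewrite -mulrA -{1}zk; exact: H.
elim: n => [_|n IH nk].
  have -> : z 0%N = y by apply/rowP => j; rewrite mxE.
  by rewrite subrr normr0 mul0r.
rewrite -(subrK (g (z n)) (g (z n.+1))) -addrA (le_trans (ler_normD _ _))//.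
rewrite -natr1 mulrDl mul1r [leRHS]addrC lerD//; last exact: (IH (ltnW nk)).
pose i := Ordinal nk.
have zE : z n.+1 = (x 0 i - y 0 i) *: evec R i + z n.
  apply/rowP => j; rewrite !mxE eqxx /=; have [->|ji] := eqVneq j i.
    by rewrite /= ltnS leqnn ltnn mulr1 subrK.
  rewrite mulr0 add0r ltnS leq_eqVlt (_ : (j == n :> nat) = false)//.
  by apply/negbTE; apply: contra ji => /eqP jn; apply/eqP/val_inj.
rewrite zE; apply: (le_trans (box_coord_lip (hg i) (bz n) _)); first by rewrite -zE; exact: bz.
by rewrite ler_wpM2l//; have := coord_le_norm (x - y) i; rewrite !mxE.
Qed.

Lemma cbox_bounded a r (F : 'rV[R]_k -> R) :
  (forall x, cbox a r x -> {for x, continuous F}) ->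
  exists M, forall x, cbox a r x -> `|F x| <= M.
Proof.
move=> cF; exact: (@compact_fun_bounded R 'rV[R]_k _ _ (@compact_cbox a r) cF).
Qed.

End box.

(** * Integrals of bounded functions with bounded support *)

Section rint.
Variables (R : realType) (k : nat).
Implicit Types g h : 'rV[R]_k -> R.
Local Notation mu := (lebesgue_rV R k).

Definition rint g : R := Rintegral mu setT g.

Lemma bmsD g h : bms g -> bms h -> bms (fun x => g x + h x).
Proof.
move=> [mg [M gM] [r gr]] [mh [M' hM] [r' hr]]; split.
- exact: measurable_funD.
- by exists (M + M') => x; rewrite (le_trans (ler_normD _ _))// lerD.
- exists (Num.max r r') => x; rewrite ge_max => /andP[rx r'x].
  by rewrite gr// hr// addr0.
Qed.

Lemma bmsZ (c : R) g : bms g -> bms (fun x => c * g x).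
Proof.
move=> [mg [M gM] [r gr]]; split.
- exact: measurable_funM.
- by exists (`|c| * M) => x; rewrite normrM ler_wpM2l.
- by exists r => x rx; rewrite gr// mulr0.
Qed.

Lemma bmsB g h : bms g -> bms h -> bms (fun x => g x - h x).
Proof.
move=> bg bh; have := bmsD bg (bmsZ (-1) bh).
by rewrite (_ : (fun x => _) = (fun x => g x - h x))//; apply/funext => x; rewrite mulN1r.
Qed.

Lemma bms0 : bms (fun _ : 'rV[R]_k => 0 : R).
Proof. by split; [exact: measurable_cst|exists 0 => x; rewrite normr0|exists 0]. Qed.

Lemma bms_sum m (G : 'I_m -> 'rV[R]_k -> R) : (forall i, bms (G i)) ->
  bms (fun x => \sum_(i < m) G i x).
Proof.
elim: m G => [|m IH] G bG.
  by rewrite (_ : (fun x => _) = (fun=> 0)); [exact: bms0|apply/funext => x; rewrite big_ord0].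
rewrite (_ : (fun x => _) = (fun x => G ord0 x + \sum_(i < m) G (lift ord0 i) x)).
  by apply: bmsD => //; exact: IH.
by apply/funext => x; rewrite big_ord_recl.
Qed.

Lemma rintD g h : bms g -> bms h -> rint (fun x => g x + h x) = rint g + rint h.
Proof. by move=> bg bh; apply: RintegralD => //; exact: bms_integrable. Qed.

Lemma rintB g h : bms g -> bms h -> rint (fun x => g x - h x) = rint g - rint h.
Proof. by move=> bg bh; apply: RintegralB => //; exact: bms_integrable. Qed.

Lemma rintZ (c : R) g : bms g -> rint (fun x => c * g x) = c * rint g.
Proof. by move=> bg; apply: RintegralZl => //; exact: bms_integrable. Qed.

Lemma rint0 : rint (fun _ : 'rV[R]_k => 0) = 0.
Proof. by rewrite /rint /Rintegral integral0_eq. Qed.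

Lemma rint_sum0 m (G : 'I_m -> 'rV[R]_k -> R) : (forall i, bms (G i)) ->
  (forall i, rint (G i) = 0) -> rint (fun x => \sum_(i < m) G i x) = 0.
Proof.
elim: m G => [|m IH] G bG G0.
  by rewrite (_ : (fun x => _) = (fun=> 0)); [exact: rint0|apply/funext => x; rewrite big_ord0].
rewrite (_ : (fun x => _) = (fun x => G ord0 x + \sum_(i < m) G (lift ord0 i) x)).
  by rewrite rintD//; [rewrite G0 IH// addr0|exact: bms_sum].
by apply/funext => x; rewrite big_ord_recl.
Qed.

Lemma rint_ae_ge0 g : bms g -> {ae mu, forall x, 0 <= g x} -> 0 <= rint g.
Proof.
move=> [mg _ _] [N [mN N0 sN]]; rewrite /rint /Rintegral.
rewrite (ae_eq_integral (fun x => (Num.max (g x) 0)%:E))//.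
- by apply: fine_ge0; apply: integral_ge0 => x _; rewrite lee_fin le_max lexx orbT.
- exact/measurable_EFinP.
- by apply/measurable_EFinP; apply: measurable_maxr.
- exists N; split => // x hx; apply: sN => gx; apply: hx => _ /=.
  by rewrite max_l.
Qed.

(** Continuity keeps [g] above [g x0 / 2] on a ball, and balls have positive measure. *)
Lemma rint_gt0 g (x0 : 'rV[R]_k) : bms g -> (forall x, 0 <= g x) ->
  {for x0, continuous g} -> 0 < g x0 -> 0 < rint g.
Proof.
move=> bg g0 cg gx0.
have g2 : 0 < g x0 / 2 by rewrite divr_gt0.
have : nbhs x0 [set x | g x0 / 2 < g x].
  have := cg; move=> /(_ [set y | g x0 / 2 < y]); apply.
  by apply: lt_nbhsr; rewrite ltr_pdivrMr// ltr_pMr// ltr1n.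
move=> /nbhs_ballP[e /= e0 he].
have /andP[B0 By] := lebesgue_rV_ball x0 e0.
have mB := measurable_ball_rV x0 e.
have bI : bms (fun x => g x0 / 2 * \1_(ball x0 e) x).
  apply: bmsZ; split.
  - exact: measurable_indic.
  - by exists 1 => x; rewrite indicE; case: (_ \in _); rewrite ?normr1 ?normr0.
  - exists (`|x0| + e) => x xr; rewrite indicE memNset// mx_norm_ball /ball_/= => xB.
    move: xr; rewrite leNgt => /negP; apply.
    by rewrite -(subKr x0 x) (le_lt_trans (ler_normB _ _))// ltrD2l.
apply: (@lt_le_trans _ _ (rint (fun x => g x0 / 2 * \1_(ball x0 e) x))).
  rewrite /rint /Rintegral.
  under eq_integral do rewrite EFinM.
  rewrite ge0_integralZl//; last 2 first.
  - by apply/measurable_EFinP; exact: measurable_indic.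
  - by rewrite lee_fin ltW.
  rewrite integral_indic// setIT fine_gt0// mule_gt0 ?lte_fin//=.
  by rewrite lte_mul_pinfty// lee_fin ltW.
apply: le_Rintegral => //; [exact: bms_integrable|exact: bms_integrable|].
move=> x _; rewrite indicE; have [xB|xB] := boolP (x \in _); last by rewrite mulr0.
by rewrite mulr1; apply: ltW; apply: he; rewrite inE in xB.
Qed.

End rint.

(** * Lipschitz functions and the density of the functional *)

Lemma lip_continuous (R : realType) (V : normedModType R) (g : V -> R) (L : R) :
  (forall x y, `|g x - g y| <= L * `|x - y|) -> continuous g.
Proof.
move=> Lg x; apply/cvgrPdist_le => e e0.
have L1 : 0 < `|L| + 1 by rewrite ltr_wpDl.
near=> y; apply: (le_trans (Lg x y)); apply: (@le_trans _ _ ((`|L| + 1) * `|x - y|)).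
  by rewrite ler_wpM2r// (le_trans (ler_norm L))// lerDl.
rewrite mulrC -ler_pdivlMr//; near: y.
by apply: cvgr_dist_le; [exact: cvg_id|rewrite divr_gt0].
Unshelve. all: by end_near. Qed.

Section lip.
Variables (R : realType) (k : nat).
Implicit Types g h : 'rV[R]_k -> R.

(** Lipschitz for the sup norm, which carries the topology of row vectors, whereas [W1inf0] refers
    to [enorm]. *)
Definition nlip (L : R) g := forall x y, `|g x - g y| <= L * `|x - y|.

Lemma nlip_continuous L g : nlip L g -> continuous g.
Proof. exact: lip_continuous. Qed.

Lemma norm_evec (i : 'I_k) : `|evec R i| <= 1.
Proof. by apply: rV_norm_le => // j; rewrite mxE eqxx /=; case: eqP; rewrite ?normr1 ?normr0. Qed.

Lemma nlip_dir L g i : nlip L g -> forall x (h : R), `|g (h *: evec R i + x) - g x| <= L * `|h|.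
Proof.
move=> Lg x h; apply: (le_trans (Lg _ _)); rewrite addrK.
have L0 : 0 <= L.
  have := le_trans (normr_ge0 _) (Lg (evec R i) 0).
  rewrite subr0 pmulr_lge0// normr_gt0; apply/eqP => /rowP/(_ i).
  by rewrite !mxE !eqxx => /eqP; rewrite oner_eq0.
by rewrite ler_wpM2l// normrZ ler_piMr// norm_evec.
Qed.

Lemma W1inf0_nlip (Om : set 'rV[R]_k) v : W1inf0 Om v -> exists L, nlip L v.
Proof.
move=> [[L Lv] _]; exists (`|L| * k.+1%:R) => x y; apply: (le_trans (Lv x y)).
apply: (@le_trans _ _ (`|L| * enorm (x - y))).
  by rewrite ler_wpM2r ?enorm_ge0// ler_norm.
by rewrite -mulrA ler_wpM2l// enorm_le_norm.
Qed.

End lip.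

Section Jdens.
Variables (R : realType) (k : nat) (sigma : R) (f df d2f : R -> R) (Om : set 'rV[R]_k).
Hypothesis Hf : standingA sigma f df d2f.
Hypothesis oOm : open Om.
Hypothesis bOm : exists M : R, forall x, Om x -> enorm x <= M.

Definition Jdens (v : 'rV[R]_k -> R) (x : 'rV[R]_k) : R :=
  if x \in Om then f (enorm (grad v x)) - v x else 0.

Lemma bms_Jdens v : W1inf0 Om v -> bms (Jdens v).
Proof.
move=> Wv; have [L Lv] := W1inf0_nlip Wv; have [M OM] := bOm.
have cv := nlip_continuous Lv.
have mv : measurable_fun setT v by exact: continuous_measurable_rV.
(* Monotonicity of [f] is known on [[0, +oo[] only; the maximum with [0] makes the outer function
   monotone on the whole line, hence measurable. *)
have JE : Jdens v = (fun x => \1_Om x * (f (Num.max (enorm (grad v x)) 0) - v x)).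
  apply/funext => x; rewrite /Jdens indicE; case: (_ \in _); last by rewrite mul0r.
  by rewrite mul1r max_l// enorm_ge0.
have nf : nondecr0 f by case: Hf => _ [_ []].
split.
- rewrite JE; apply: measurable_funM.
    by apply: measurable_indic; exact: open_measurable_rV.
  apply: measurable_funB => //.
  apply: (@measurableT_comp _ _ _ _ R R (fun t => f (Num.max t 0)) _ (fun x => enorm (grad v x))).
    apply: nondecreasing_measurable => // a b ab; apply: nf.
    by rewrite le_max lexx orbT/= ge_max !le_max ab lexx orbT.
  rewrite /enorm; apply: (@measurableT_comp _ _ _ _ R R (@Num.sqrt R)).
    apply: continuous_measurable_fun; exact: sqrt_continuous.
  apply: measurable_sum => i; apply: measurable_funX.
  under eq_fun do rewrite mxE.
  exact: measurable_derive.
- have dB x i : `|derive v x (evec R i)| <= L + `|point : R|.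
    exact: (derive_bounded (nlip_dir i Lv)).
  pose K := k.+1%:R * `|L + `|point : R| |.
  exists (`|f 0| + `|f K| + (`|v 0| + `|L| * `|M|)) => x.
  rewrite /Jdens; case: ifPn => [xO|_]; last first.
    by rewrite normr0 !addr_ge0// mulr_ge0.
  rewrite (le_trans (ler_normB _ _))// lerD//.
    have K1 : 0 <= enorm (grad v x) <= K.
      rewrite enorm_ge0/= (le_trans (enorm_le_norm _))// ler_wpM2l//.
      apply: rV_norm_le => // i; rewrite mxE; exact: le_trans (dB x i) (ler_norm _).
    have h1 : f 0 <= f (enorm (grad v x)) by apply: nf; rewrite lexx; case/andP: K1.
    have h2 : f (enorm (grad v x)) <= f K by exact: nf.
    rewrite ler_norml; have := ler_norm (f K); have := ler_norm (- f 0); rewrite normrN.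
    have := normr_ge0 (f 0); have := normr_ge0 (f K); lra.
  rewrite inE in xO.
  rewrite -(subrK (v 0) (v x)) (le_trans (ler_normD _ _))// addrC lerD2l.
  apply: (le_trans (Lv _ _)); rewrite subr0; apply: (@le_trans _ _ (`|L| * `|x|)).
    by rewrite ler_wpM2r// ler_norm.
  rewrite ler_wpM2l// (le_trans (norm_le_enorm x))// (le_trans (OM x xO))//.
  exact: ler_norm.
- exists (M + 1) => x xM; rewrite /Jdens ifF//; apply/negP => /set_mem xO.
  have := le_trans xM (le_trans (norm_le_enorm x) (OM x xO)).
  by rewrite leNgt ltrDl ltr01.
Qed.

Lemma Jfun_rint v : W1inf0 Om v -> Jfun f Om v = rint (Jdens v).
Proof. by move=> Wv; exact: bms_iint (bms_Jdens Wv). Qed.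

End Jdens.

(** * Comparison with a touching test function *)

Section local.
Variable R : realType.

Lemma near_norm (V : normedModType R) (x : V) (P : V -> Prop) (e : R) :
  0 < e -> (forall y, `|x - y| < e -> P y) -> \forall y \near x, P y.
Proof. by move=> e0 h; apply/nbhs_normP; exists e. Qed.

Lemma cont_near_eq (T : topologicalType) (F G : T -> R) (x : T) :
  (\forall y \near x, G y = F y) -> {for x, continuous G} -> {for x, continuous F}.
Proof.
move=> FG cG; have -> : {for x, continuous F} = (F y @[y --> x] --> F x) by [].
rewrite -(nbhs_singleton FG); apply: cvg_trans cG; exact: near_eq_cvg.
Qed.

(** At a minimum the quotients for [d / 2] and [- (d / 2)] have opposite signs, and both are close
    to the derivative. *)
Lemma derive_min0 k (w : 'rV[R]_k -> R) x v : (forall y, 0 <= w y) -> w x = 0 ->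
  derivable w x v -> derive w x v = 0.
Proof.
move=> w0 wx dw; apply/eqP; rewrite -normr_le0; apply/ler_addgt0Pr => e e0; rewrite add0r.
have /is_derive_dquotP/(_ e e0)[d d0 hd] := derivableP dw.
have d2 : 0 < d / 2 by rewrite divr_gt0.
have d2d : d / 2 < d by rewrite ltr_pdivrMr// ltr_pMr// ltr1n.
have := hd (d / 2); rewrite gt_eqF// gtr0_norm// => /(_ erefl d2d).
have := hd (- (d / 2)); rewrite oppr_eq0 gt_eqF// normrN gtr0_norm// => /(_ erefl d2d).
have q1 : dquot w v x (- (d / 2)) <= 0.
  by rewrite /dquot wx subr0 invrN mulNr oppr_le0 mulr_ge0// invr_ge0 ltW.
have q2 : 0 <= dquot w v x (d / 2) by rewrite /dquot wx subr0 mulr_ge0// invr_ge0 ltW.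
rewrite !ler_norml => /andP[h1 h2] /andP[h3 h4]; lra.
Qed.

Lemma max0_lip (a b : R) : `|Num.max a 0 - Num.max b 0| <= `|a - b|.
Proof.
case: (leP a 0) => a0; case: (leP b 0) => b0; rewrite ?subrr ?normr0// ?sub0r ?subr0.
  rewrite normrN gtr0_norm// distrC (le_trans _ (ler_norm _))//; lra.
rewrite gtr0_norm// (le_trans _ (ler_norm _))//; lra.
Qed.

End local.

Section touching.
Variables (R : realType) (k : nat) (sigma : R) (f df d2f : R -> R).
Variables (Om : set 'rV[R]_k) (u phi : 'rV[R]_k -> R) (x0 : 'rV[R]_k) (s r : R).
(** [D i] stands for the derivative of [flux i] along [evec R i]; it is abstract so that a vanishing
    flux and a flux with nonzero gradient are treated alike. *)
Variable D : 'I_k -> 'rV[R]_k -> R.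
Hypothesis Hf : standingA sigma f df d2f.
Hypothesis oOm : open Om.
Hypothesis bOm : exists M : R, forall x, Om x -> enorm x <= M.
Hypothesis min_u : is_minimizer f Om u.
Hypothesis s_sign : s = 1 \/ s = -1.
Hypothesis r_gt0 : 0 < r.
Hypothesis rOm : cbox x0 r `<=` Om.
Hypothesis touch0 : u x0 = phi x0.
Hypothesis touch : forall x, Om x -> x != x0 -> s * (u x - phi x) < 0.
Hypothesis phi_cont : forall x, cbox x0 r x -> {for x, continuous phi}.
Hypothesis phi_derivable : forall i x, cbox x0 r x -> derivable phi x (evec R i).
Hypothesis phi_derive_cont : forall i x, cbox x0 r x ->
  {for x, continuous (fun y => derive phi y (evec R i))}.

Definition flux (i : 'I_k) (x : 'rV[R]_k) : R :=
  df (enorm (grad phi x)) / enorm (grad phi x) * grad phi x 0 i.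

Hypothesis flux_derive : forall i x, cbox x0 r x -> is_derive x (evec R i) (flux i) (D i x).
Hypothesis flux_cont : forall i x, cbox x0 r x -> {for x, continuous (flux i)}.
Hypothesis D_cont : forall i x, cbox x0 r x -> {for x, continuous (D i)}.
Hypothesis D_sign : forall x, cbox x0 r x -> 0 < - s * (\sum_i D i x + 1).

Let ss : s * s = 1. Proof. by case: s_sign => ->; lra. Qed.
Let ns : `|s| = 1. Proof. by case: s_sign => ->; rewrite ?normrN normr1. Qed.
Let Wu : W1inf0 Om u. Proof. by case: min_u. Qed.

Let u_cont : continuous u.
Proof. by have [L Lu] := W1inf0_nlip Wu; exact: nlip_continuous Lu. Qed.

(** On the compact shell between radii [r / 2] and [r] the function [s * (u - phi)] is negative, so
    its reciprocal is continuous, hence bounded, and the function stays away from zero. *)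
Lemma gap : exists2 del, 0 < del &
  forall x, cbox x0 r x -> r / 2 <= `|x - x0| -> s * (u x - phi x) <= - del.
Proof.
pose K : set 'rV[R]_k := cbox x0 r `&` [set x | r / 2 <= `|x - x0|].
have cK : compact K.
  apply: compact_closedI; first exact: compact_cbox.
  exact: (preimage_closed (fun x _ => @cont_dist R 'rV[R]_k x0 x) (@closed_ge R (r / 2))).
have K0 x : K x -> s * (u x - phi x) < 0.
  move=> [bx rx]; apply: touch; first exact: rOm.
  apply/eqP => xx0; move: rx; rewrite /= xx0 subrr normr0 leNgt => /negP; apply.
  by rewrite divr_gt0.
have [|M hM] := compact_fun_bounded (f := fun x => (s * (u x - phi x))^-1) cK.
  move=> x Kx; apply: (@continuousV R _ (fun x => s * (u x - phi x))).
    by rewrite lt_eqF// K0.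
  apply: contM; first exact: cont_cst.
  by apply: contB; [exact: u_cont|apply: phi_cont; case: Kx].
have M1 : 0 < `|M| + 1 by rewrite ltr_wpDl.
exists (`|M| + 1)^-1; first by rewrite invr_gt0.
move=> x bx rx; have Kx : K x by [].
have := hM x Kx; have := K0 x Kx; set y := s * _ => y0.
rewrite normfV ltr0_norm// => h.
rewrite lerNr -[leRHS]invrK lef_pV2 ?posrE ?invr_gt0 ?oppr_gt0//.
by rewrite (le_trans h)// (le_trans (ler_norm M))// lerDl.
Qed.

Section competitor.
Variable del : R.
Hypothesis del_gt0 : 0 < del.
Hypothesis gapP : forall x, cbox x0 r x -> r / 2 <= `|x - x0| -> s * (u x - phi x) <= - del.

(** By [gapP] the positive part already vanishes on the shell, so that the extension by zero outside
    the box creates no jump. *)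
Definition bump (x : 'rV[R]_k) : R :=
  if `|x - x0| <= r then Num.max (s * (u x - phi x) + del) 0 else 0.
Local Notation w := bump.

Let w_box x : cbox x0 r x -> w x = Num.max (s * (u x - phi x) + del) 0.
Proof. by rewrite /bump => ->. Qed.

Let w_ge0 x : 0 <= w x.
Proof. by rewrite /bump; case: ifP => // _; rewrite le_max lexx orbT. Qed.

Let w_far x : r / 2 <= `|x - x0| -> w x = 0.
Proof.
move=> rx; rewrite /bump; case: ifP => // bx; apply: max_r.
by have := gapP bx rx; lra.
Qed.

Let w_le x : w x <= del.
Proof.
rewrite /bump; case: ifP => [bx|_]; last exact: ltW.
rewrite ge_max (ltW del_gt0) andbT.
have [->|xx0] := eqVneq x x0; first by rewrite touch0 subrr mulr0 add0r.
have := touch (rOm bx) xx0; lra.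
Qed.

Let w_x0 : w x0 = del.
Proof. by rewrite w_box /cbox/= ?subrr ?normr0 ?ltW// touch0 subrr mulr0 add0r max_l// ltW. Qed.

(** Either [x] is in the shell and [w x = 0], or [x] and [y] are at least [r / 2] apart while
    [w x <= del]; hence the slope [2 * del / r]. *)
Let w_lip_cross L x y : 2 * del / r <= L -> cbox x0 r x -> ~ cbox x0 r y ->
  `|w x - w y| <= L * `|x - y|.
Proof.
move=> dL bx nby.
have yr : r < `|y - x0| by rewrite ltNge; apply/negP.
rewrite [w y]w_far ?subr0; last by have := r_gt0; lra.
have L0 : 0 <= L by apply: le_trans dL; rewrite divr_ge0 ?mulr_ge0// ltW.
have [rx|xr] := leP (r / 2) `|x - x0|; first by rewrite w_far// normr0 mulr_ge0.
rewrite ger0_norm//; apply: (le_trans (w_le x)).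
have xy : r / 2 <= `|x - y|.
  have : `|y - x0| <= `|x - y| + `|x - x0|.
    by rewrite -(subrK x y) -addrA (distrC x) subrK; exact: ler_normD.
  lra.
apply: (@le_trans _ _ (2 * del / r * (r / 2))).
  by rewrite le_eqVlt; apply/orP; left; apply/eqP; field; rewrite gt_eqF.
by rewrite ler_pM// ?divr_ge0 ?mulr_ge0// ltW.
Qed.

Lemma bump_lip : exists L, nlip L w.
Proof.
have [Lu hu] := W1inf0_nlip Wu.
have /choice[M hM] : forall i : 'I_k, exists M : R,
    forall x, cbox x0 r x -> `|derive phi x (evec R i)| <= M.
  by move=> i; apply: cbox_bounded => x; exact: phi_derive_cont.
pose C := \sum_i `|M i|.
have hC i x : cbox x0 r x -> derivable phi x (evec R i) /\ `|derive phi x (evec R i)| <= C.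
  move=> bx; split; first exact: phi_derivable.
  rewrite (le_trans (hM i x bx))// (le_trans (ler_norm _))//.
  by rewrite /C (bigD1 i)//= lerDl sumr_ge0.
have Lphi := box_lip hC.
(* The first constant serves two points of the box, the second a pair separated by its boundary. *)
pose L := Num.max (Lu + k%:R * C) (2 * del / r).
have dL : 2 * del / r <= L by rewrite le_max lexx orbT.
have L0 : 0 <= L by apply: le_trans dL; rewrite divr_ge0 ?mulr_ge0// ltW.
exists L => x y.
have [bx|nbx] := pselect (cbox x0 r x); have [by_|nby] := pselect (cbox x0 r y).
- rewrite !w_box// (le_trans (max0_lip _ _))//.
  rewrite (_ : _ - _ = s * ((u x - u y) - (phi x - phi y))); last by ring.
  rewrite normrM ns mul1r (le_trans (ler_normB _ _))//.
  apply: (@le_trans _ _ ((Lu + k%:R * C) * `|x - y|)).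
    by rewrite mulrDl lerD// ?hu// Lphi.
  by rewrite ler_wpM2r// le_max lexx.
- exact: w_lip_cross.
- by rewrite distrC (distrC x); exact: w_lip_cross.
- have far z : ~ cbox x0 r z -> w z = 0.
    move=> nbz; apply: w_far; have : r < `|z - x0| by rewrite ltNge; apply/negP.
    by have := r_gt0; lra.
  by rewrite !far// subrr normr0 mulr_ge0.
Qed.

Let w_cont : continuous w.
Proof. by have [L Lw] := bump_lip; exact: nlip_continuous Lw. Qed.

Let w_far_near x : ~ cbox x0 r x -> \forall y \near x, w y = 0.
Proof.
move=> nbx; apply: (@near_norm R 'rV[R]_k _ _ (r / 2)); first by rewrite divr_gt0.
move=> y xy; apply: w_far.
have xr : r < `|x - x0| by rewrite ltNge; apply/negP.
have : `|x - x0| <= `|x - y| + `|y - x0| by rewrite -{1}(subrK y x) -addrA; exact: ler_normD.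
lra.
Qed.

(** The factor [a] is controlled on the box only, but [w] vanishes near every point outside it. *)
Lemma bump_mul_cont (a : 'rV[R]_k -> R) : (forall x, cbox x0 r x -> {for x, continuous a}) ->
  continuous (fun x => a x * w x).
Proof.
move=> ca x; have [bx|nbx] := pselect (cbox x0 r x).
  by apply: (@contM R 'rV[R]_k a w); [exact: ca|exact: w_cont].
apply: (@cont_near_eq _ 'rV[R]_k (fun x => a x * w x) (fun=> 0)); last exact: cont_cst.
have := w_far_near nbx; apply: filterS => y ->; by rewrite mulr0.
Qed.

Let w_support : exists rr : R, forall x, rr <= `|x| -> w x = 0.
Proof.
exists (`|x0| + r) => x rx; apply: w_far.
have : `|x| <= `|x - x0| + `|x0| by rewrite -{1}(subrK x0 x); exact: ler_normD.
have := r_gt0; lra.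
Qed.

Lemma bump_mul_bms (a : 'rV[R]_k -> R) : (forall x, cbox x0 r x -> {for x, continuous a}) ->
  bms (fun x => a x * w x).
Proof.
move=> ca; split.
- by apply: continuous_measurable_rV; exact: bump_mul_cont.
- have [M hM] := cbox_bounded ca; exists (`|M| * del) => x.
  have [bx|nbx] := pselect (cbox x0 r x).
    rewrite normrM ler_pM// ?(le_trans (hM x bx)) ?ler_norm//.
    by rewrite ger0_norm.
  by rewrite (nbhs_singleton (w_far_near nbx)) mulr0 normr0 mulr_ge0// ltW.
- by have [rr h] := w_support; exists rr => x /h ->; rewrite mulr0.
Qed.

(** In turn the field [A w], the gain [- s (div A + 1) w], and the competitor, which equals
    [phi - s * del] where [w > 0] because [s * s = 1]. *)
Let g (i : 'I_k) x := flux i x * w x.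
Let e x := - s * (\sum_i D i x + 1) * w x.
Let v x := u x - s * w x.

Let e_coef_cont x : cbox x0 r x -> {for x, continuous (fun x => - s * (\sum_i D i x + 1))}.
Proof.
move=> bx; apply: contM; first exact: cont_cst.
apply: contD; last exact: cont_cst.
by apply: cont_sum => i; exact: D_cont.
Qed.

(** Of [flux i] only the derivative along its own axis is given, so the Lipschitz bound is along
    that axis too; this is the form used by [integral_derive_eq0]. *)
Let g_dir i : exists L, forall x (h : R), `|g i (h *: evec R i + x) - g i x| <= L * `|h|.
Proof.
have [L Lw] := bump_lip; have hw := nlip_dir i Lw.
have [MA hA] := cbox_bounded (@flux_cont i).
have [MD hD] := cbox_bounded (@D_cont i).
have hl : forall x (h : R), cbox x0 r x -> cbox x0 r (h *: evec R i + x) ->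
    `|flux i (h *: evec R i + x) - flux i x| <= MD * `|h|.
  apply: box_coord_lip => x bx; have [d1 d2] := flux_derive i bx.
  by split; [exact: d1|rewrite d2; exact: hD].
have L0 : 0 <= L by have := hw 0 1; rewrite normr1 mulr1; apply: le_trans.
exists (`|MA| * L + del * `|MD|) => x h.
have far z : ~ cbox x0 r z -> w z = 0 by move=> /w_far_near/nbhs_singleton.
have A_le z : cbox x0 r z -> `|flux i z| <= `|MA|.
  by move=> bz; rewrite (le_trans (hA z bz))// ler_norm.
(* With one endpoint outside the box, where [w] is zero, the Lipschitz bound of [w] alone controls
   the increment. *)
have half : forall a b, cbox x0 r a -> ~ cbox x0 r b -> `|w a - w b| <= L * `|h| ->
    `|flux i a * w a| <= (`|MA| * L + del * `|MD|) * `|h|.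
  move=> a b ba nbb; rewrite (far b)// subr0 => hab.
  rewrite normrM mulrDl -(addr0 (`|flux i a| * _)) lerD//; last by rewrite !mulr_ge0// ltW.
  by rewrite -mulrA ler_pM// A_le.
have [bx|nbx] := pselect (cbox x0 r x); have [by_|nby] := pselect (cbox x0 r (h *: evec R i + x)).
- rewrite /g; set y := h *: _ + x in by_ *.
  rewrite (_ : _ - _ = flux i y * (w y - w x) + w x * (flux i y - flux i x)); last by ring.
  rewrite (le_trans (ler_normD _ _))// mulrDl lerD// normrM -mulrA ler_pM//.
  + exact: A_le.
  + exact: hw.
  + by rewrite ger0_norm.
  + apply: (le_trans (hl x h bx by_)); by rewrite ler_wpM2r// ler_norm.
- rewrite /g [w (h *: _ + x)]far// mulr0 sub0r normrN.
  by apply: half bx nby _; rewrite distrC.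
- rewrite /g [w x]far// mulr0 subr0.
  exact: half by_ nbx _.
- by rewrite /g !far// !mulr0 subrr normr0 mulr_ge0// addr_ge0// mulr_ge0// ltW.
Qed.

Let v_W : W1inf0 Om v.
Proof.
have [L Lw] := bump_lip; have [Lu hu] := W1inf0_nlip Wu.
split.
  exists (`|Lu + L|) => x y; rewrite /v.
  apply: (@le_trans _ _ ((Lu + L) * `|x - y|)).
    rewrite (_ : _ - _ = (u x - u y) - s * (w x - w y)); last by ring.
    by rewrite (le_trans (ler_normB _ _))// mulrDl lerD// normrM ns mul1r.
  apply: (@le_trans _ _ (`|Lu + L| * `|x - y|)); first by rewrite ler_wpM2r// ler_norm.
  by rewrite ler_wpM2l// norm_le_enorm.
move=> x nOx; rewrite /v; case: Wu => _ -> //.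
by rewrite (nbhs_singleton (w_far_near (fun bx => nOx (rOm bx)))) mulr0 subr0.
Qed.

(* On [w > 0] the gradient of [v] is that of [phi], and the convexity inequality for the
   integrand applies; on [w = 0] the nonnegative function [w] has zero gradient. *)
Let pointwise x : (forall i, derivable u x (evec R i)) -> (forall i, derivable w x (evec R i)) ->
  0 <= Jdens f Om u x - Jdens f Om v x - s * (\sum_i derive (g i) x (evec R i)) - e x.
Proof.
move=> du dw.
have dv i : is_derive x (evec R i) v (derive u x (evec R i) - s * derive w x (evec R i)).
  exact: (is_deriveB (derivableP (du i)) (is_deriveZ s (derivableP (dw i)))).
have dvE i : derive v x (evec R i) = derive u x (evec R i) - s * derive w x (evec R i).
  exact: (@derive_val _ _ _ _ _ _ _ (dv i)).
have dg i : cbox x0 r x -> derive (g i) x (evec R i) =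
    flux i x * derive w x (evec R i) + w x * D i x.
  move=> bx.
  have H : is_derive x (evec R i) (g i) (flux i x *: derive w x (evec R i) + w x *: D i x).
    exact: (is_deriveM (flux_derive i bx) (derivableP (dw i))).
  exact: (@derive_val _ _ _ _ _ _ _ H).
have := w_ge0 x; rewrite le_eqVlt => /orP[/eqP/esym wx0|wx].
  have dw0 i : derive w x (evec R i) = 0 by exact: derive_min0.
  have gE : grad v x = grad u x by apply/rowP => i; rewrite !mxE dvE dw0 mulr0 subr0.
  have dg0 i : derive (g i) x (evec R i) = 0.
    have [bx|nbx] := pselect (cbox x0 r x); first by rewrite dg// dw0 wx0 mulr0 mul0r addr0.
    have H : is_derive x (evec R i) (g i) 0.
      apply: (near_eq_is_derive (f := cst 0)).
      by have := w_far_near nbx; apply: filterS => y wy; rewrite /g wy mulr0.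
    exact: (@derive_val _ _ _ _ _ _ _ H).
  have JE : Jdens f Om v x = Jdens f Om u x by rewrite /Jdens gE /v wx0 mulr0 subr0.
  rewrite JE big1 => [|i _]; last exact: dg0.
  by rewrite /e wx0 !mulr0 !subr0 subrr.
have xr : `|x - x0| < r / 2.
  by rewrite ltNge; apply/negP => /w_far wx0; move: wx; rewrite wx0 ltxx.
have bx : cbox x0 r x by rewrite /cbox/=; have := r_gt0; move: xr; lra.
have wE : \forall y \near x, s * (u y - phi y) + del = w y.
  near=> y.
  have wy : 0 < w y by near: y; exact: (w_cont (lt_nbhsr wx)).
  have by_ : cbox x0 r y.
    have [//|nby] := pselect (cbox x0 r y).
    by move: wy; rewrite (nbhs_singleton (w_far_near nby)) ltxx.
  move: wy; rewrite w_box// lt_max ltxx orbF => wy; rewrite max_l// ltW//.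
have dwE i : derive w x (evec R i) = s * (derive u x (evec R i) - derive phi x (evec R i)).
  have H : is_derive x (evec R i) (fun y => s * (u y - phi y) + del)
      (s *: (derive u x (evec R i) - derive phi x (evec R i)) + 0).
    have H1 := is_deriveZ s (is_deriveB (derivableP (du i)) (derivableP (@phi_derivable i x bx))).
    exact (@is_deriveD _ _ _ _ _ _ _ _ _ H1 (is_derive_cst del x (evec R i))).
  have := near_eq_is_derive wE H; rewrite addr0 => H'.
  exact: (@derive_val _ _ _ _ _ _ _ H').
have gE : grad v x = grad phi x.
  by apply/rowP => i; rewrite !mxE dvE dwE mulrA ss mul1r subKr.
have xO : x \in Om by rewrite inE; exact: rOm.
rewrite /Jdens xO gE /v /e.
have := flux_monotone Hf (grad phi x) (grad u x).
have -> : \sum_i df (enorm (grad phi x)) / enorm (grad phi x) * grad phi x 0 i *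
    (grad u x 0 i - grad phi x 0 i) = s * \sum_i flux i x * derive w x (evec R i).
  rewrite mulr_sumr; apply: eq_bigr => i _; rewrite -/(flux i x) dwE !mxE.
  by rewrite [RHS]mulrCA (mulrA s s) ss mul1r.
have -> : \sum_i derive (g i) x (evec R i) =
    \sum_i flux i x * derive w x (evec R i) + w x * \sum_i D i x.
  by rewrite mulr_sumr -big_split/=; apply: eq_bigr => i _; rewrite dg.
set S := \sum_i _ * _; set T := \sum_i D i x; move=> h.
(* The terms [s * w] and [s * w * T] cancel against [e], which leaves the tangent inequality at
   [grad phi x]. *)
rewrite [leRHS](_ : _ = f (enorm (grad u x)) - f (enorm (grad phi x)) - s * S); last by ring.
by rewrite subr_ge0.
Unshelve. all: by end_near. Qed.

Let bms_dg i : bms (fun x => derive (g i) x (evec R i)) /\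
  rint (fun x => derive (g i) x (evec R i)) = 0.
Proof.
have [L hL] := g_dir i.
have cg : continuous (g i) by exact: (bump_mul_cont (@flux_cont i)).
have sg : exists rr : R, forall x, rr <= `|x| -> g i x = 0.
  by have [rr h] := w_support; exists rr => x /h wx; rewrite /g wx mulr0.
split; first exact: (bms_derive cg hL sg).
rewrite /rint /Rintegral (integral_derive_eq0 cg hL sg)//.
exact: (bump_mul_bms (@flux_cont i)).
Qed.

Let ae_all (q : 'rV[R]_k -> R) : (exists L, nlip L q) ->
  {ae lebesgue_rV R k, forall x, forall i, derivable q x (evec R i)}.
Proof.
move=> [L Lq].
(* The axes are indexed by all naturals, vacuously from [k] on, so that the countable intersection
   of full sets applies. *)
have H : {ae lebesgue_rV R k, forall x, forall n (i : 'I_k), i = n :> nat -> derivable q x (evec R i)}.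
  apply: ae_foralln => n; have [nk|kn] := ltnP n k; last first.
    by apply: aeW => x i ni; have := ltn_ord i; rewrite ni ltnNge kn.
  have [N [mN N0 sN]] := ae_derivable (nlip_continuous Lq) (nlip_dir (Ordinal nk) Lq).
  exists N; split => // x hx; apply: sN => dx; apply: hx => i ni.
  by rewrite (_ : i = Ordinal nk)//; exact/val_inj.
have [N [mN N0 sN]] := H; exists N; split => // x hx; apply: sN => dx; apply: hx => i.
exact: (dx i i).
Qed.

Lemma competitor_absurd : False.
Proof.
have bU := bms_Jdens Hf oOm bOm Wu.
have bV := bms_Jdens Hf oOm bOm v_W.
have be : bms e by exact: (bump_mul_bms e_coef_cont).
have bS : bms (fun x => \sum_i derive (g i) x (evec R i)).
  by apply: bms_sum => i; case: (bms_dg i).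
have bx0 : cbox x0 r x0 by rewrite /cbox/= subrr normr0 ltW.
have e_pos : 0 < rint e.
  apply: (rint_gt0 (x0 := x0)) => //.
  - move=> x; have [bx|nbx] := pselect (cbox x0 r x).
      by rewrite /e mulr_ge0// ltW// D_sign.
    by rewrite /e (nbhs_singleton (w_far_near nbx)) mulr0.
  - exact: (bump_mul_cont e_coef_cont).
  - by rewrite /e w_x0 mulr_gt0// D_sign.
have : 0 <= rint (fun x => Jdens f Om u x - Jdens f Om v x
    - s * (\sum_i derive (g i) x (evec R i)) - e x).
  apply: rint_ae_ge0; first by do 2 apply: bmsB => //; [exact: bmsB|exact: bmsZ].
  have [N [mN N0 sN]] := ae_all (W1inf0_nlip Wu).
  have [N' [mN' N'0 sN']] := ae_all bump_lip.
  exists (N `|` N'); split; first exact: measurableU.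
    by apply/eqP; rewrite eq_le measure_ge0 andbT -(adde0 0%E) -{1}N0 -N'0; exact: measureU2.
  move=> x hx; have [h1|h1] := pselect (N x); first by left.
  have [h2|h2] := pselect (N' x); first by right.
  exfalso; apply: hx; apply: pointwise => i; apply: contrapT => h.
    by apply: h1; apply: sN => /= H; exact: h (H i).
  by apply: h2; apply: sN' => /= H; exact: h (H i).
rewrite rintB//; last by apply: bmsB; [exact: bmsB|exact: bmsZ].
rewrite rintB//; [|exact: bmsB|exact: bmsZ].
rewrite rintB// rintZ// rint_sum0; [|by move=> i; case: (bms_dg i)..].
have [_ /(_ _ v_W)] := min_u.
rewrite (Jfun_rint Hf oOm bOm Wu) (Jfun_rint Hf oOm bOm v_W); lra.
Qed.

End competitor.

Theorem no_touching : False.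
Proof. by have [del d0 hd] := gap; exact: (competitor_absurd d0 hd). Qed.

End touching.

(** * Flux and divergence of a twice continuously differentiable test function *)

Section test_function.
Variables (R : realType) (k : nat) (Om : set 'rV[R]_k) (phi : 'rV[R]_k -> R).
Hypothesis oOm : open Om.
Hypothesis Cphi : C2_on Om phi.

Let p j (x : 'rV[R]_k) : R := derive phi x (evec R j).
Let H i j (x : 'rV[R]_k) : R := derive (p j) x (evec R i).
Let N (x : 'rV[R]_k) : R := enorm (grad phi x).

Let NE x : N x = Num.sqrt (\sum_j p j x ^+ 2).
Proof. by rewrite /N /enorm; congr Num.sqrt; apply: eq_bigr => j _; rewrite mxE. Qed.

Let p_cont j x : Om x -> {for x, continuous (p j)}.
Proof. by move=> Ox; have [_ /(_ j)[_ []]] := Cphi Ox. Qed.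

Let H_cont i j x : Om x -> {for x, continuous (H i j)}.
Proof. by move=> Ox; have [_ /(_ i)[_ [_ /(_ j)[]]]] := Cphi Ox. Qed.

Let p_derive i j x : Om x -> is_derive x (evec R i) (p j) (H i j x).
Proof. by move=> Ox; have [_ /(_ i)[_ [_ /(_ j)[d _]]]] := Cphi Ox; exact: derivableP. Qed.

Let N_cont x : Om x -> {for x, continuous N}.
Proof.
move=> Ox; rewrite (_ : N = (@Num.sqrt R) \o (fun x => \sum_j p j x ^+ 2)); last first.
  by apply/funext => y; rewrite NE.
apply: (@continuous_comp 'rV[R]_k R R); last exact: sqrt_continuous.
apply: cont_sum => j; apply: contM; exact: p_cont.
Qed.

Lemma cbox_of_nbhs (x0 : 'rV[R]_k) (P : set 'rV[R]_k) : nbhs x0 P ->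
  exists2 r, 0 < r & cbox x0 r `<=` P.
Proof.
move=> /nbhs_ballP[e /= e0 he]; exists (e / 2); first by rewrite divr_gt0.
move=> x; rewrite /cbox/= => xe; apply: he; rewrite mx_norm_ball /ball_/= distrC.
by rewrite (le_lt_trans xe)// ltr_pdivrMr// ltr_pMr// ltr1n.
Qed.

Variables (sigma : R) (f df d2f : R -> R) (u : 'rV[R]_k -> R) (x0 : 'rV[R]_k) (s : R).
Hypothesis Hf : standingA sigma f df d2f.
Hypothesis Hdf : C2_pos df d2f.
Hypothesis bOm : exists M : R, forall x, Om x -> enorm x <= M.
Hypothesis min_u : is_minimizer f Om u.
Hypothesis s_sign : s = 1 \/ s = -1.
Hypothesis Ox0 : Om x0.
Hypothesis touch0 : u x0 = phi x0.
Hypothesis touch : forall x, Om x -> x != x0 -> s * (u x - phi x) < 0.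

Let fluxE i : flux df phi i = (fun x => coef2 df (N x) * p i x).
Proof. by apply/funext => x; rewrite /flux /coef2 /N mxE. Qed.

(** The set [U] is the region where the flux is regular. The strict sign at [x0] persists nearby by
    continuity of the [D i], so that all requirements of [no_touching] hold on a small closed
    box. *)
Lemma not_touching (U : set 'rV[R]_k) (D : 'I_k -> 'rV[R]_k -> R) : nbhs x0 U ->
  (forall i x, Om x -> U x -> is_derive x (evec R i) (flux df phi i) (D i x)) ->
  (forall i x, Om x -> U x -> {for x, continuous (flux df phi i)}) ->
  (forall i x, Om x -> U x -> {for x, continuous (D i)}) ->
  0 < - s * (\sum_i D i x0 + 1) -> False.
Proof.
move=> xU d1 c1 c2 s0.
have Ux0 : U x0 by exact: nbhs_singleton.
have cS : {for x0, continuous (fun x => - s * (\sum_i D i x + 1))}.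
  apply: contM; first exact: cont_cst.
  apply: contD; last exact: cont_cst.
  by apply: cont_sum => i; exact: c2.
have nS : nbhs x0 [set x | 0 < - s * (\sum_i D i x + 1)] by exact: (cS _ (lt_nbhsr s0)).
have nO : nbhs x0 Om by exact: open_nbhs_nbhs.
have [r r0 hr] := cbox_of_nbhs (filterI nO (filterI xU nS)).
apply: (@no_touching R k sigma f df d2f Om u phi x0 s r D) => //.
- by move=> x /hr[].
- by move=> x /hr[/Cphi[]].
- by move=> i x /hr[Ox _]; have [_ /(_ i)[]] := Cphi Ox.
- by move=> i x /hr[Ox _]; exact: p_cont.
- by move=> i x /hr[Ox [Ux _]]; exact: d1.
- by move=> i x /hr[Ox [Ux _]]; exact: c1.
- by move=> i x /hr[Ox [Ux _]]; exact: c2.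
- by move=> x /hr[_ []].
Qed.

(* Where the gradient is shorter than [sigma] the flux vanishes identically. *)
Lemma not_touching_small : s = -1 -> enorm (grad phi x0) < sigma -> False.
Proof.
move=> sE Ns.
pose U := [set x | Om x /\ N x < sigma].
have oU x : Om x -> N x < sigma -> nbhs x U.
  move=> Ox Nx; apply: filterI; first exact: open_nbhs_nbhs.
  exact: (N_cont Ox (lt_nbhsl Nx)).
have U0 i x : U x -> 0 = flux df phi i x.
  move=> [_ Nx]; rewrite /flux; case: Hf => _ [_ [_ [_ [_ [_ [_ [df0 _]]]]]]].
  by rewrite df0 ?mul0r// enorm_ge0 ltW.
have near0 i x : U x -> \forall y \near x, cst 0 y = flux df phi i y.
  by move=> [Ox Nx]; apply: filterS (oU x Ox Nx) => y; exact: U0.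
apply: (@not_touching U (fun _ _ => 0)).
- exact: oU.
- move=> i x _ Ux; exact: (near_eq_is_derive (near0 i x Ux)).
- by move=> i x _ Ux; apply: (cont_near_eq (near0 i x Ux)); exact: cont_cst.
- by move=> i x _ _; exact: cont_cst.
- by rewrite big1// sE opprK mul1r add0r.
Qed.

Let D i x : R :=
  coef1 df d2f (N x) * (\sum_j p j x * H i j x) * p i x + coef2 df (N x) * H i i x.

Let D_derive i x : Om x -> 0 < N x -> is_derive x (evec R i) (flux df phi i) (D i x).
Proof.
move=> Ox Nx.
have := @flux_derive1 R df d2f Hdf k (fun j t => p j (t *: evec R i + x)) (fun j => H i j x) 0 i.
rewrite /= scale0r add0r -NE fluxE => /(_ _ Nx) h.
rewrite -[X in is_derive X](add0r x) -(scale0r (evec R i)); apply/is_derive_line.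
rewrite (_ : (fun t => _) = (fun t => coef2 df (Num.sqrt (\sum_j p j (t *: evec R i + x) ^+ 2))
   * p i (t *: evec R i + x))); last by apply/funext => t; rewrite NE.
apply: h => j; apply/is_derive_line; rewrite scale0r add0r; exact: p_derive.
Qed.

Let df_cont t : 0 < t -> {for t, continuous df}.
Proof.
move=> t0; have [[d _] _] := Hdf t0; apply: differentiable_continuous.
exact/derivable1_diffP.
Qed.

Let coef2_cont t : 0 < t -> {for t, continuous (coef2 df)}.
Proof.
move=> t0; apply: contM; first exact: df_cont.
by apply: (@continuousV R R id); [rewrite gt_eqF|exact: cvg_id].
Qed.

Let coef1_cont t : 0 < t -> {for t, continuous (coef1 df d2f)}.
Proof.
move=> t0; apply: contM.
  apply: contB; last exact: df_cont.
  by apply: contM; [exact: cvg_id|have [_] := Hdf t0].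
apply: (@continuousV R R (fun y => y ^+ 3)); first by rewrite gt_eqF// exprn_gt0.
exact: exprn_continuous.
Qed.

Let D_cont i x : Om x -> 0 < N x -> {for x, continuous (D i)}.
Proof.
move=> Ox Nx.
have cN := N_cont Ox.
have c1 : {for x, continuous (coef1 df d2f \o N)} by apply: continuous_comp => //; exact: coef1_cont.
have c2 : {for x, continuous (coef2 df \o N)} by apply: continuous_comp => //; exact: coef2_cont.
apply: contD; last by apply: contM => //; exact: H_cont.
apply: contM; last exact: p_cont.
apply: contM => //; apply: cont_sum => j.
by apply: contM; [exact: p_cont|exact: H_cont].
Qed.

(** The divergence of the flux in nondivergence form, the opposite of the second-order part of the
    first entry of [Gop]. *)
Let trE : \sum_i D i x0 = coef1 df d2f (N x0) *
    (grad phi x0 *m hess phi x0 *m (grad phi x0)^T) 0 0 + coef2 df (N x0) * \tr (hess phi x0).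
Proof.
rewrite /D big_split/= /mxtrace; congr (_ + _).
  rewrite mxE mulr_sumr.
  under [RHS]eq_bigr do rewrite !mxE mulr_suml mulr_sumr.
  rewrite exchange_big/=; apply: eq_bigr => i _.
  rewrite mulr_sumr mulr_suml; apply: eq_bigr => j _; rewrite !mxE /p /H /p; ring.
by rewrite mulr_sumr; apply: eq_bigr => i _; rewrite !mxE.
Qed.

(** The gradient stays nonzero near [x0], where [coef1], [coef2] and the norm are continuous along
    it. *)
Lemma not_touching_large : 0 < enorm (grad phi x0) ->
  0 < - s * (coef1 df d2f (N x0) * (grad phi x0 *m hess phi x0 *m (grad phi x0)^T) 0 0 +
    coef2 df (N x0) * \tr (hess phi x0) + 1) -> False.
Proof.
move=> N0; rewrite -trE; apply: (@not_touching [set x | 0 < N x]).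
- exact: (N_cont Ox0 (lt_nbhsr N0)).
- by move=> i x Ox Nx; exact: D_derive.
- move=> i x Ox Nx; rewrite fluxE; apply: contM; last exact: p_cont.
  apply: (@continuous_comp 'rV[R]_k R R N (coef2 df)); [exact: N_cont|exact: coef2_cont].
- by move=> i x Ox Nx; exact: D_cont.
Qed.

End test_function.

(* The domain lives in R^N with N = n.+1, so N >= 2 is (1 <= n)%N. *)
Theorem theorem3p2 (R : realType) (n : nat) (Om : set 'rV[R]_n.+1) (alpha sigma : R)
  (f df d2f : R -> R) (fn dfn d2fn : nat -> R -> R) (u : 'rV[R]_n.+1 -> R) :
  (1 <= n)%N ->
  0 < alpha < 1 ->
  bounded_domain Om ->
  C2alpha_boundary alpha Om ->
  standingA sigma f df d2f ->
  C2_pos df d2f ->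
  approx_seq sigma f df d2f fn dfn d2fn ->
  is_minimizer f Om u ->
  visc_solution (@Gop R sigma df d2f n.+1) Om u.
Proof.
move=> _ _ [_ [oOm [_ bOm]]] _ Hf Hdf _ min_u.
have sig0 : 0 < sigma by case: Hf.
have gradN0 (P : 'rV[R]_n.+1) : 0 < enorm P -> P == 0 = false.
  by move=> P0; apply/negbTE; apply: contraTneq P0 => ->; rewrite enorm0 ltxx.
have [L Lu] := W1inf0_nlip min_u.1.
split; first exact/continuous_subspaceT/(nlip_continuous Lu).
split=> x0 phi Ox0 Cphi touch0 touch; rewrite leNgt; apply/negP.
(* A positive minimum makes both entries positive; the second one gives a gradient longer than
   [sigma], hence nonzero. *)
- rewrite /Gop lt_min => /andP[+ Ps].
  have P0 : 0 < enorm (grad phi x0) by rewrite (lt_trans sig0)// -subr_gt0.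
  rewrite gradN0// => G0.
  apply: (@not_touching_large _ _ Om phi oOm Cphi sigma f df d2f u x0 1) => //.
  + by left.
  + by move=> x Ox xx0; rewrite mul1r subr_lt0; exact: touch.
  + by move: G0; rewrite /coef1 /coef2; lra.
- rewrite /Gop gt_min => G0.
  have touch' x : Om x -> x != x0 -> -1 * (u x - phi x) < 0.
    by move=> Ox xx0; rewrite mulN1r oppr_lt0 subr_gt0; exact: touch.
  (* A gradient shorter than [sigma] is contradictory whatever the first entry of [Gop]; otherwise
     the second entry is nonnegative, so the first one is negative. *)
  have [Ps|Ps] := ltP (enorm (grad phi x0)) sigma.
    by apply: (@not_touching_small _ _ Om phi oOm Cphi sigma f df d2f u x0 (-1)) => //; right.
  have P0 : 0 < enorm (grad phi x0) by rewrite (lt_le_trans sig0).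
  move: G0; rewrite gradN0// (ltNge (_ - sigma)) subr_ge0 Ps orbF => G0.
  apply: (@not_touching_large _ _ Om phi oOm Cphi sigma f df d2f u x0 (-1)) => //.
  + by right.
  + by move: G0; rewrite /coef1 /coef2; lra.
Qed.
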